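(* Let $A\in\mathbb{C}^{n\times n}$, let $G,H\in\mathbb{C}^{n\times n}$ be Hermitian positive semidefinite, and let $r>1$ be an integer. Assume that $\mathbb{R}_{\geq}\neq\emptyset$ and $H\neq 0$. Then the sequence $\{\widehat{H}_k\}$ generated by the accelerated fixed-point iteration AFPI with parameter $r$ (described in the context) converges R-superlinearly, with at least order $r$, to the minimal positive semidefinite solution $X_\star$ of the equation $X=R_{\rm d}(X)$. Moreover, $$\limsup_{k\to\infty}\sqrt[r^k]{\|\widehat{H}_k-X_\star\|}\;\leq\;\max\{|\lambda|^2:\ \lambda\in\sigma(T_{X_\star})\cap\mathbb{D}\}.$$
   Context: Notation: $\mathbb{N}_n$ is the set of $n\times n$ Hermitian positive semidefinite matrices; $\ast$ is conjugate transpose; $M\geq N$ means that $M,N$ are Hermitian and $M-N$ is positive semidefinite; $\sigma(\cdot)$ is the spectrum; $\mathbb{D}$ is the open unit disk in $\mathbb{C}$; $\|\cdot\|$ is an induced matrix norm. The discrete-time algebraic Riccati equation (DARE) is $X=R_{\rm d}(X)$ with $R_{\rm d}(X):=H+A^\ast X(I+GX)^{-1}A$ (for $X\in\mathbb{N}_n$ the matrix $I+GX$ is invertible). Put $T_X:=(I+GX)^{-1}A$ and $\mathbb{R}_{\geq}:=\{X\in\mathbb{N}_n:\ X\geq R_{\rm d}(X)\}$. The minimal positive semidefinite solution is the solution $X_\star\in\mathbb{N}_n$ of $X=R_{\rm d}(X)$ with $X_\star\leq S$ for every solution $S\in\mathbb{N}_n$. AFPI: Let $\mathbb{K}_n:=\mathbb{C}^{n\times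 n}\times\mathbb{N}_n\times\mathbb{N}_n$ and define $F:\mathbb{K}_n\times\mathbb{K}_n\to\mathbb{K}_n$, for $Y=(Y_1,Y_2,Y_3)$ and $Z=(Z_1,Z_2,Z_3)$, by $$F(Y,Z)=\bigl(Z_1\Delta Y_1,\ Z_2+Z_1\Delta Y_2Z_1^\ast,\ Y_3+Y_1^\ast Z_3\Delta Y_1\bigr),\qquad \Delta=(I+Y_2Z_3)^{-1}.$$ Start with $\widehat{\mathbb{X}}_0=(A,G,H)$. For $k=0,1,2,\dots$ set $\mathbb{X}_k^{(1)}=\widehat{\mathbb{X}}_k$, $\mathbb{X}_k^{(\ell+1)}=F(\widehat{\mathbb{X}}_k,\mathbb{X}_k^{(\ell)})$ for $\ell=1,\dots,r-2$, and $\widehat{\mathbb{X}}_{k+1}=F(\widehat{\mathbb{X}}_k,\mathbb{X}_k^{(r-1)})$. Write $\widehat{\mathbb{X}}_k=(\widehat{A}_k,\widehat{G}_k,\widehat{H}_k)$. A sequence $X_k$ converges R-superlinearly to $X_\star$ with at least order $r$ ($r>1$ an integer) if $\limsup_{k\to\infty}\sqrt[r^k]{\|X_k-X_\star\|}\leq\sigma$ for some $\sigma\in(0,1)$. *)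

(* Defs.v *)
From mathcomp Require Import all_boot all_order all_algebra.
From mathcomp Require Import complex.
From mathcomp Require Import all_classical all_reals all_analysis.

Set Implicit Arguments.
Unset Strict Implicit.
Unset Printing Implicit Defensive.

Import Order.TTheory GRing.Theory Num.Theory.
Import ComplexField.Normc.

Local Open Scope classical_set_scope.
Local Open Scope complex_scope.
Local Open Scope ring_scope.
Local Open Scope sesquilinear_scope.

(* The complex numbers are R[i] for R : realType, and M ^t* is the conjugate
   transpose. The modulus of a complex number is taken in R, hence normc;
   the library's `|z| lives in R[i]. *)

(* The order 0 <= z on R[i] means that z is real and nonnegative. *)
Definition psdmx (R : realType) (n : nat) (M : 'M[R[i]]_n) : Prop :=
  M \is hermsymmx /\ forall x : 'cV[R[i]]_n, 0 <= (x ^t* *m M *m x) 0 0.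

Definition loewner_ge (R : realType) (n : nat) (M N : 'M[R[i]]_n) : Prop :=
  [/\ M \is hermsymmx, N \is hermsymmx & psdmx (M - N)].

(* In this file invmx is only meaningful at products of the form 1 + G X with
   G and X positive semidefinite, which are invertible; invmx B is B when B is
   singular. *)
Definition dareT (R : realType) (n : nat) (A G X : 'M[R[i]]_n) : 'M[R[i]]_n :=
  invmx (1%:M + G *m X) *m A.

Definition dareR (R : realType) (n : nat) (A G H X : 'M[R[i]]_n) :
    'M[R[i]]_n :=
  H + A ^t* *m X *m invmx (1%:M + G *m X) *m A.

Definition dare_supersol (R : realType) (n : nat) (A G H : 'M[R[i]]_n) :
    set 'M[R[i]]_n :=
  [set X | psdmx X /\ loewner_ge X (dareR A G H X)].

Definition dare_psd_sol (R : realType) (n : nat) (A G H : 'M[R[i]]_n) :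
    set 'M[R[i]]_n :=
  [set X | psdmx X /\ X = dareR A G H X].

Definition dare_min_psd_sol (R : realType) (n : nat)
    (A G H X : 'M[R[i]]_n) : Prop :=
  dare_psd_sol A G H X /\
  forall S, dare_psd_sol A G H S -> loewner_ge S X.

Definition afpiF (R : realType) (n : nat)
    (Y Z : 'M[R[i]]_n * 'M[R[i]]_n * 'M[R[i]]_n) :
    'M[R[i]]_n * 'M[R[i]]_n * 'M[R[i]]_n :=
  let: (Y1, Y2, Y3) := Y in
  let: (Z1, Z2, Z3) := Z in
  let D := invmx (1%:M + Y2 *m Z3) in
  (Z1 *m D *m Y1,
   Z2 + Z1 *m D *m Y2 *m Z1 ^t*,
   Y3 + Y1 ^t* *m Z3 *m D *m Y1).

(* afpi_inner Xh l is X_k^(l+1), for Xh the k-th outer iterate. *)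
Fixpoint afpi_inner (R : realType) (n : nat)
    (Xh : 'M[R[i]]_n * 'M[R[i]]_n * 'M[R[i]]_n) (l : nat) :
    'M[R[i]]_n * 'M[R[i]]_n * 'M[R[i]]_n :=
  if l is l'.+1 then afpiF Xh (afpi_inner Xh l') else Xh.

(* The inner index r - 2 stands for X_k^(r-1); the iteration is meant for
   r > 1 only. *)
Fixpoint afpi (R : realType) (n r : nat) (A G H : 'M[R[i]]_n) (k : nat) :
    'M[R[i]]_n * 'M[R[i]]_n * 'M[R[i]]_n :=
  if k is k'.+1 then
    let Xh := afpi r A G H k' in afpiF Xh (afpi_inner Xh (r - 2))
  else (A, G, H).

Definition afpiH (R : realType) (n r : nat) (A G H : 'M[R[i]]_n) (k : nat) :
    'M[R[i]]_n :=
  let: (_, _, Hk) := afpi r A G H k in Hk.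

Definition vector_norm (R : realType) (n : nat) (N : 'cV[R[i]]_n -> R) :
    Prop :=
  [/\ forall x, N x = 0 -> x = 0,
      forall x y, N (x + y) <= N x + N y
    & forall c x, N (c *: x) = normc c * N x].

(* For n = 0 the set is empty and the norm is sup set0 = 0; otherwise the set
   is nonempty and bounded. *)
Definition induced_norm (R : realType) (n : nat) (N : 'cV[R[i]]_n -> R)
    (M : 'M[R[i]]_n) : R :=
  sup [set N (M *m x) | x in [set x | N x = 1]].

Definition limsup_root (R : realType) (n : nat) (nrm : 'M[R[i]]_n -> R)
    (r : nat) (X : nat -> 'M[R[i]]_n) (Xs : 'M[R[i]]_n) : \bar R :=
  limn_esup (fun k => (nrm (X k - Xs) `^ ((r ^ k)%:R^-1))%:E).

Definition R_superlinear_cvg (R : realType) (n : nat)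
    (nrm : 'M[R[i]]_n -> R) (r : nat) (X : nat -> 'M[R[i]]_n)
    (Xs : 'M[R[i]]_n) : Prop :=
  exists2 s : R, 0 < s < 1 & (limsup_root nrm r X Xs <= s%:E)%E.

Definition is_max (R : realType) (S : set R) (m : R) : Prop :=
  S m /\ ubound S m.

(* The library's eigenvalue is defined with row eigenvectors, which gives the
   same spectrum. *)
Definition spectrum (R : realType) (n : nat) (M : 'M[R[i]]_n) : set R[i] :=
  [set lam | eigenvalue M lam].

Definition unit_disk (R : realType) : set R[i] := [set lam | normc lam < 1].

(* Main.v *)
Require Import Defs.
From mathcomp Require Import all_boot all_order all_algebra.
From mathcomp Require Import complex.
From mathcomp Require Import all_classical all_reals all_analysis.
From mathcomp Require Import ring lra.
Import ComplexField.Normc.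

Set Implicit Arguments.
Unset Strict Implicit.
Unset Printing Implicit Defensive.

Import Order.TTheory GRing.Theory Num.Theory.
Import numFieldNormedType.Exports.

Local Open Scope sesquilinear_scope.
Local Open Scope classical_set_scope.
Local Open Scope complex_scope.
Local Open Scope ring_scope.

(* Write X for the limit of the increasing fixed-point iterates h_j = R_d^j(0),
   which is the minimal solution, and T for T_X. The AFPI iterate of index k is
   the triple (a, g, h_j) attached to the j-fold composition of R_d, j = r^k,
   and
     X - h_j = (T^j)^* (X + X g X) T^j.
   In particular X T^j tends to 0, so X is annihilated by the product of the
   factors T - z over the eigenvalues z of T in the open disk, and X T^j decays
   like tau^j as soon as tau exceeds their moduli. It remains to bound
   X + X g X uniformly in j. Since g = (1 + g X) W_j with
   W_j = \sum_(k < j) T^k (1 + G X)^-1 G (T^k)^*, this matrix is inverse to the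
   defect D_j = X - X W_j X on the range of X, and D_j decreases to some D, so
   it suffices that D and X have the same kernel. A vector of ker D outside
   ker X would give an expanding mode of A not observed by H; such a mode is in
   the kernel of all the h_j, hence of X. *)

(** * Algebra of positive semidefinite matrices *)

Section PsdMatrices.

Variable C : numClosedFieldType.

(* [psdmx] is the instance [C := R[i]]. *)
Definition is_psd n (M : 'M[C]_n) : Prop :=
  M \is hermsymmx /\ forall x : 'cV[C]_n, 0 <= (x ^t* *m M *m x) 0 0.

Lemma adjmxM m n p (A : 'M[C]_(m, n)) (B : 'M[C]_(n, p)) :
  (A *m B) ^t* = B ^t* *m A ^t* .
Proof. by rewrite trmx_mul map_mxM. Qed.

Lemma adjmxD m n (A B : 'M[C]_(m, n)) : (A + B) ^t* = A ^t* + B ^t* .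
Proof. by rewrite linearD map_mxD. Qed.

Lemma adjmxB m n (A B : 'M[C]_(m, n)) : (A - B) ^t* = A ^t* - B ^t* .
Proof. by rewrite linearB map_mxB. Qed.

Lemma adjmx1 n : (1%:M : 'M[C]_n) ^t* = 1%:M.
Proof. by rewrite trmx1 map_mx1. Qed.

Lemma adjmx0 m n : (0 : 'M[C]_(m, n)) ^t* = 0.
Proof. by rewrite trmx0 map_mx0. Qed.

Lemma adjmx_inv n (A : 'M[C]_n) : (invmx A) ^t* = invmx (A ^t* ).
Proof. by rewrite trmx_inv map_invmx. Qed.

Lemma hermsymmxP n (M : 'M[C]_n) : M \is hermsymmx <-> M ^t* = M.
Proof.
split=> [/is_hermitianmxP|hM]; first by rewrite expr0 scale1r => <-.
by apply/is_hermitianmxP; rewrite expr0 scale1r.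
Qed.

Lemma psd_herm n (M : 'M[C]_n) : is_psd M -> M ^t* = M.
Proof. by case=> /hermsymmxP. Qed.

Lemma adjmx_mul_self m n (S : 'M[C]_(m, n)) j :
  (S ^t* *m S) j j = \sum_i `|S i j| ^+ 2.
Proof.
by rewrite mxE; apply: eq_bigr => i _; rewrite !mxE mulrC -normCK.
Qed.

Lemma psd_gram m n (S : 'M[C]_(m, n)) : is_psd (S ^t* *m S).
Proof.
split; first by apply/hermsymmxP; rewrite adjmxM trmxCK.
move=> x; rewrite mulmxA -adjmxM -mulmxA adjmx_mul_self.
by apply: sumr_ge0 => i _; rewrite exprn_ge0.
Qed.

(** From the spectral decomposition [M = P^* diag(d) P], with [S = diag(sqrt d) P]; each [d_i] is
    the value of the form of [M] at the vector [P^* e_i], hence nonnegative. *)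
Lemma psd_factor n (M : 'M[C]_n) :
  is_psd M -> exists S : 'M[C]_n, M = S ^t* *m S.
Proof.
move=> [hM pM]; set P := spectralmx M; set d := spectral_diag M.
have MP : M = P ^t* *m diag_mx d *m P.
  rewrite -invmx_unitary ?spectral_unitarymx //.
  exact/orthomx_spectralP/hermitian_normalmx.
have PP : P *m P ^t* = 1%:M by apply/unitarymxP/spectral_unitarymx.
have d_ge0 i : 0 <= d 0 i.
  have := pM (P ^t* *m (delta_mx i 0)).
  rewrite MP adjmxM trmxCK !mulmxA !mulmxtVK ?spectral_unitarymx //.
  by rewrite trmx_delta map_delta_mx -mulmxA -colE -rowE !mxE eqxx mulr1n.
exists (diag_mx (\row_i sqrtC (d 0 i)) *m P).
rewrite adjmxM MP !mulmxA; congr (_ *m _); rewrite -[RHS]mulmxA; congr (_ *m _).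
rewrite tr_diag_mx map_diag_mx mulmx_diag; congr diag_mx; apply/rowP => i.
rewrite !mxE; have := d_ge0 i; rewrite -sqrtC_ge0 => /geC0_conj E.
by rewrite -[LHS]sqrtCK expr2; congr (_ * _); exact/esym/E.
Qed.

Lemma psd0 n : is_psd (0 : 'M[C]_n).
Proof. by have := psd_gram (0 : 'M[C]_n); rewrite mulmx0. Qed.

Lemma psdD n (M N : 'M[C]_n) : is_psd M -> is_psd N -> is_psd (M + N).
Proof.
move=> [/hermsymmxP hM pM] [/hermsymmxP hN pN]; split.
  by apply/hermsymmxP; rewrite adjmxD hM hN.
by move=> x; rewrite mulmxDr mulmxDl mxE addr_ge0.
Qed.

Lemma psd_congr n m (M : 'M[C]_n) (B : 'M[C]_(n, m)) :
  is_psd M -> is_psd (B ^t* *m M *m B).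
Proof.
move=> /psd_factor[S ->].
by rewrite !mulmxA -adjmxM -mulmxA; exact: psd_gram.
Qed.

Lemma psd_congrV n m (M : 'M[C]_n) (B : 'M[C]_(m, n)) :
  is_psd M -> is_psd (B *m M *m B ^t* ).
Proof. by move=> /(psd_congr (B ^t* )); rewrite trmxCK. Qed.

Lemma psd_diag_ge0 n (M : 'M[C]_n) j : is_psd M -> 0 <= M j j.
Proof.
move=> /psd_factor[S ->]; rewrite adjmx_mul_self.
by apply: sumr_ge0 => i _; rewrite exprn_ge0.
Qed.

Lemma gram_eq0 m n (S : 'M[C]_(m, n)) : S ^t* *m S = 0 -> S = 0.
Proof.
move=> S0; apply/matrixP => i j; rewrite mxE; apply/eqP.
have := congr1 (fun M : 'M[C]_n => M j j) S0.
rewrite adjmx_mul_self mxE => /eqP.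
rewrite psumr_eq0 => [/allP/(_ i)|k _]; last by rewrite exprn_ge0.
by rewrite mem_index_enum => /(_ isT); rewrite sqrf_eq0 normr_eq0.
Qed.

(** If [M = S^* S], then [K M K^*] is the Gram matrix of [S K^*], which therefore vanishes. This is
    how vanishing forms become linear relations below. *)
Lemma psd_ker n m (M : 'M[C]_n) (K : 'M[C]_(m, n)) :
  is_psd M -> K *m M *m K ^t* = 0 -> K *m M = 0.
Proof.
move=> /psd_factor[S ->] KSSK.
suff /(congr1 (fun A => A ^t* )) : S *m K ^t* = 0.
  by rewrite adjmxM trmxCK adjmx0 mulmxA => ->; rewrite mul0mx.
by apply: gram_eq0; rewrite adjmxM trmxCK -KSSK !mulmxA.
Qed.

(** The diagonal entries of [M] and [N] are nonnegative with sum 0, and those of [M = S^* S] are the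
    squared norms of the columns of [S]. *)
Lemma psd_addr_eq0 n (M N : 'M[C]_n) :
  is_psd M -> is_psd N -> M + N = 0 -> M = 0.
Proof.
move=> pM pN MN0; have [S MS] := psd_factor pM.
rewrite MS; suff -> : S = 0 by rewrite mulmx0.
apply/matrixP => i j; rewrite mxE; apply/eqP.
have := congr1 (fun M : 'M[C]_n => M j j) MN0; rewrite !mxE => /eqP.
rewrite paddr_eq0 ?psd_diag_ge0 // => /andP[+ _].
rewrite MS adjmx_mul_self.
rewrite psumr_eq0 => [/allP/(_ i)|k _]; last by rewrite exprn_ge0.
by rewrite mem_index_enum => /(_ isT); rewrite sqrf_eq0 normr_eq0.
Qed.

End PsdMatrices.

(** * Resolvents of [1 + G X] and the addition of levels *)

Section Riccati.

Variables (C : numClosedFieldType) (n : nat).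
Implicit Types A G H X Y T M : 'M[C]_n.

(** A left null vector [w] satisfies [w G w^* + (w G) X (w G)^* = 0], so [w G X = 0] by positivity,
    and then [w = 0]. *)
Lemma unitmx_1addM G X : is_psd G -> is_psd X -> 1%:M + G *m X \in unitmx.
Proof.
move=> pG pX; rewrite -row_free_unit; apply: inj_row_free => w.
rewrite mulmxDr mulmx1 mulmxA => w0.
have hG := psd_herm pG.
have wGX0 : w *m G *m X = 0.
  apply: psd_ker => //; rewrite adjmxM hG mulmxA.
  apply: (@psd_addr_eq0 _ _ _ (w *m G *m w ^t* )).
  - by have := psd_congrV (w *m G) pX; rewrite adjmxM hG !mulmxA.
  - exact: psd_congrV.
  by rewrite -!mulmxDl addrC w0 !mul0mx.
by move: w0; rewrite wGX0 addr0.
Qed.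

(** The push-through identity, from [X (1 + G X) = (1 + X G) X]. *)
Lemma mulmx_resolvent G X : is_psd G -> is_psd X ->
  X *m invmx (1%:M + G *m X) = invmx (1%:M + X *m G) *m X.
Proof.
move=> pG pX; have uGX := unitmx_1addM pG pX; have uXG := unitmx_1addM pX pG.
apply: (canRL (mulKmx uXG)); rewrite mulmxA.
apply: (canLR (mulmxK uGX)).
by rewrite mulmxDl mulmxDr mul1mx mulmx1 mulmxA.
Qed.

Lemma adjmx_1addM G X : is_psd G -> is_psd X ->
  (1%:M + G *m X) ^t* = 1%:M + X *m G.
Proof.
by move=> pG pX; rewrite adjmxD adjmx1 adjmxM (psd_herm pG) (psd_herm pX).
Qed.

(** A congruence of [X + X G X] by the inverse of [1 + G X]. *)
Lemma psd_resolvent G X : is_psd G -> is_psd X ->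
  is_psd (X *m invmx (1%:M + G *m X)).
Proof.
move=> pG pX; set S := invmx _.
have -> : X *m S = S ^t* *m (X + X *m G *m X) *m S.
  rewrite adjmx_inv adjmx_1addM //.
  have -> : X + X *m G *m X = (1%:M + X *m G) *m X by rewrite mulmxDl mul1mx.
  by rewrite mulKmx // unitmx_1addM.
apply: psd_congr; apply: psdD => //.
by have := psd_congr X pG; rewrite (psd_herm pX).
Qed.

Lemma psd_resolventV G X : is_psd G -> is_psd X ->
  is_psd (invmx (1%:M + G *m X) *m G).
Proof.
by move=> pG pX; rewrite -mulmx_resolvent //; exact: psd_resolvent.
Qed.

Lemma invmx_1addM G X : is_psd G -> is_psd X ->
  invmx (1%:M + G *m X) = 1%:M - invmx (1%:M + G *m X) *m G *m X.
Proof.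
move=> pG pX; have u := unitmx_1addM pG pX; apply/esym.
by rewrite -mulmxA -{1}(mulVmx u) -mulmxBr addrK mulmx1.
Qed.

Lemma adjmx_invmx_1addM G X : is_psd G -> is_psd X ->
  (invmx (1%:M + G *m X)) ^t* = 1%:M - X *m invmx (1%:M + G *m X) *m G.
Proof.
move=> pG pX; rewrite [in LHS]invmx_1addM // adjmxB adjmx1 adjmxM.
rewrite (psd_herm (psd_resolventV pG pX)) (psd_herm pX).
by rewrite mulmxA.
Qed.

(** The factorization [1 + G Y = (1 + G X) (1 + G' D)] with [G' = (1 + G X)^-1 G] turns the
    difference into a congruence of the resolvent [D (1 + G' D)^-1]. *)
Lemma resolvent_mono G X Y :
  is_psd G -> is_psd X -> is_psd Y -> is_psd (Y - X) ->
  is_psd (Y *m invmx (1%:M + G *m Y) - X *m invmx (1%:M + G *m X)).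
Proof.
move=> pG pX pY; set D := Y - X; move=> pD.
have uX := unitmx_1addM pG pX; have uY := unitmx_1addM pG pY.
set S := invmx (1%:M + G *m X); pose G' := S *m G.
have pG' : is_psd G' by exact: psd_resolventV.
have uD := unitmx_1addM pG' pD.
have EY : 1%:M + G *m Y = (1%:M + G *m X) *m (1%:M + G' *m D).
  rewrite mulmxDr mulmx1 /G' !mulmxA mulmxV // mul1mx -addrA -mulmxDr.
  by rewrite /D [X + _]addrC subrK.
suff -> : Y *m invmx (1%:M + G *m Y) - X *m S =
    S ^t* *m (D *m invmx (1%:M + G' *m D)) *m S.
  exact/psd_congr/psd_resolvent.
apply: (can_inj (mulmxK uY)); rewrite mulmxBl mulmxKV // {1}EY.
rewrite !mulmxA mulmxKV // EY mulmxA mulmxKV // mulmxKV //.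
rewrite adjmx_invmx_1addM // mulmxDr mulmx1 mulmxBl mul1mx /G' /D -/S.
by rewrite !mulmxA opprD addrA.
Qed.

(** A finite-horizon controllability Gramian. With [(1 + G X)^-1 G] in place of [G] it is the matrix
    [W_j] introduced above. *)
Definition closed_loop_gram T G j :=
  \sum_(k < j) T ^+ k *m G *m (T ^+ k) ^t* .

Lemma closed_loop_gramD T G i j : closed_loop_gram T G (i + j) =
  closed_loop_gram T G j +
  T ^+ j *m closed_loop_gram T G i *m (T ^+ j) ^t* .
Proof.
rewrite /closed_loop_gram addnC big_split_ord /=; congr (_ + _).
rewrite mulmx_sumr mulmx_suml; apply: eq_bigr => k _.
by rewrite exprD -mulmxE adjmxM !mulmxA.
Qed.

(* The triple of the [j]-fold composition of [R_d], read in the coordinates of a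
   solution [X]: here [T] is [T_X] and [G] stands for [(1 + G X)^-1 G]. In this
   form levels add under [F] by a direct computation, and the associativity of
   [F] is not needed. *)
Definition afpi_level X T G j (a g h : 'M[C]_n) : Prop :=
  [/\ is_psd g, is_psd h, a = (1%:M + g *m X) *m T ^+ j,
      g = (1%:M + g *m X) *m closed_loop_gram T G j
    & X - h = (T ^+ j) ^t* *m (1%:M + X *m g) *m X *m T ^+ j].

Lemma afpi_levelM X T G i j a g h b k l : is_psd X ->
  afpi_level X T G i a g h -> afpi_level X T G j b k l ->
  let D := invmx (1%:M + g *m l) in
  afpi_level X T G (i + j) (b *m D *m a) (k + b *m D *m g *m b ^t* )
    (h + a ^t* *m l *m D *m a).
Proof.
move=> pX [pg ph Ea Eg Eh] [pk pl Eb Ek El] D; rewrite /afpi_level.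
rewrite closed_loop_gramD.
set P := T ^+ i in Ea Eh; set Q := T ^+ j in Eb El *.
have -> : T ^+ (i + j) = Q *m P by rewrite addnC exprD.
set W := closed_loop_gram T G i in Eg *.
set W' := closed_loop_gram T G j in Ek *.
set N := 1%:M + g *m X in Ea Eg; set M := 1%:M + k *m X in Eb Ek.
pose E := X - l.
have EM : M ^t* = 1%:M + X *m k by rewrite adjmx_1addM.
have bE : b ^t* = Q ^t* *m M ^t* by rewrite Eb adjmxM.
have EE : b ^t* *m X *m Q = E by rewrite bE EM /E El.
pose Th := D *m N.
have DgT : D *m g = Th *m W by rewrite /Th -mulmxA -Eg.
have DaT : D *m a = Th *m P by rewrite /Th -mulmxA -Ea.
have ThE : Th = 1%:M + Th *m W *m E.
  rewrite -DgT /Th /E /N mulmxDr mulmx1 mulmxBr !mulmxA [X in _ = X]addrC.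
  rewrite -addrA; have -> : 1%:M = D + D *m g *m l.
    by rewrite -mulmxA -[X in X + _]mulmx1 -mulmxDr mulVmx // unitmx_1addM.
  by rewrite [_ + (D + _)]addrC addrAC -!addrA addNr addr0 addrC.
set U := b *m D *m g *m b ^t* .
have EN : 1%:M + (k + U) *m X = M + U *m X by rewrite mulmxDl addrA.
have aE : b *m D *m a = (1%:M + (k + U) *m X) *m (Q *m P).
  have -> : b *m D *m a = M *m Q *m Th *m P by rewrite -mulmxA DaT Eb mulmxA.
  have UE : U *m X *m (Q *m P) = M *m Q *m (Th *m W *m E) *m P.
    by rewrite -DgT -EE -Eb !mulmxA.
  rewrite EN mulmxDl UE mulmxA -mulmxDl -[X in (X + _) *m P]mulmx1 -mulmxDr.
  by rewrite -ThE.
have pgn : is_psd (k + U).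
  apply: psdD => //; rewrite /U -(mulmxA b); apply: psd_congrV.
  exact: psd_resolventV.
have phn : is_psd (h + a ^t* *m l *m D *m a).
  apply: psdD => //; rewrite -(mulmxA (a ^t* ) l); apply: psd_congr.
  exact: psd_resolvent.
split=> //.
- rewrite EN; have -> : U = M *m Q *m (Th *m W) *m Q ^t* *m M ^t* .
    by rewrite -DgT -(mulmxA _ (Q ^t* )) -bE -Eb /U !mulmxA.
  set V := M *m Q *m (Th *m W) *m Q ^t* .
  have MX : M ^t* *m X = X *m M.
    by rewrite EM mulmxDl mulmxDr mulmx1 mul1mx mulmxA.
  have VX : V *m M ^t* *m X *m Q = M *m Q *m (Th *m W *m E).
    by rewrite -EE bE /V !mulmxA.
  (* Here [Th W = W + Th W E W]. The remaining term [V M^* X W'] equals [V X k], and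
     [V + V X k = V M^* = U]. *)
  have VE : M *m (Q *m W *m Q ^t* ) +
      V *m M ^t* *m X *m (Q *m W *m Q ^t* ) = V.
    rewrite !(mulmxA (V *m _ *m X)) VX [in RHS]/V [in RHS]ThE.
    rewrite (mulmxDl 1%:M) mul1mx (mulmxDr (M *m Q)) (mulmxDl (_ *m W)).
    by rewrite !mulmxA.
  rewrite mulmxDr (mulmxDl M _ W') (mulmxDl M) -Ek -addrA; congr (_ + _).
  move: V {VX} VE => V VE.
  by rewrite VE -(mulmxA V) MX -!mulmxA -Ek EM mulmxDr mulmx1 addrC.
(* The new error is [a^* (X - l Th) P], and [XlT] is again [ThE], read with [D^* = 1 - l D g]. *)
- have XlT : X - l *m Th = D ^t* *m E.
    rewrite adjmx_invmx_1addM // mulmxBl mul1mx -(mulmxA l) DgT -mulmxA.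
    by rewrite {1}ThE mulmxDr mulmx1 opprD addrA.
  have -> : (Q *m P) ^t* *m (1%:M + X *m (k + U)) = (b *m D *m a) ^t* .
    by rewrite aE [in RHS]adjmxM adjmx_1addM.
  have -> : (b *m D *m a) ^t* *m X *m (Q *m P) = a ^t* *m (D ^t* *m E) *m P.
    by rewrite !adjmxM -EE !mulmxA.
  rewrite -XlT mulmxBr mulmxBl opprD addrA Eh -/P; congr (_ - _).
    by rewrite Ea adjmxM /N adjmx_1addM // !mulmxA.
  by rewrite -(mulmxA _ D) DaT !mulmxA.
Qed.

(** The Riccati equation enters the levels only here, through the error identity. *)
Lemma afpi_level1 A G H X : is_psd G -> is_psd H -> is_psd X ->
  X = H + A ^t* *m X *m invmx (1%:M + G *m X) *m A ->
  let S := invmx (1%:M + G *m X) in afpi_level X (S *m A) (S *m G) 1 A G H.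
Proof.
move=> pG pH pX EX S; have u := unitmx_1addM pG pX; split => //.
- by rewrite expr1 mulKVmx.
- rewrite /closed_loop_gram big_ord1 expr0 -idmxE adjmx1 mul1mx mulmx1.
  by rewrite mulKVmx.
rewrite expr1 adjmxM adjmx_inv adjmx_1addM // mulmxKV ?unitmx_1addM //.
by rewrite {1}EX addrAC subrr add0r -/S !mulmxA.
Qed.

End Riccati.

(** * Invariance of the row space of [X] and the kernel of the defect *)

Section Kernels.

Variables (C : numClosedFieldType) (n : nat).
Implicit Types A G H X Y T M D V : 'M[C]_n.

(** On the kernel of [X] the forms of [M] and [X - M] are nonnegative and add up to 0. *)
Lemma psd_submx X M : is_psd M -> is_psd (X - M) -> (M <= X)%MS.
Proof.
move=> pM pXM; rewrite submxE; apply/eqP; set N := cokermx X.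
have hM := psd_herm pM.
suff /(congr1 (fun A => A ^t* )) : N ^t* *m M = 0.
  by rewrite adjmxM trmxCK hM adjmx0.
apply: psd_ker => //; rewrite trmxCK.
apply: (@psd_addr_eq0 _ _ _ (N ^t* *m (X - M) *m N)).
- exact: psd_congr.
- exact: psd_congr.
by rewrite -mulmxDl -mulmxDr addrC subrK -mulmxA mulmx_coker mulmx0.
Qed.

Section Solution.

Variables (A G H X : 'M[C]_n).
Hypotheses (pG : is_psd G) (pH : is_psd H) (pX : is_psd X).
Let S := invmx (1%:M + G *m X).
Hypothesis EX : X = H + A ^t* *m X *m S *m A.

Let uS : S \in unitmx. Proof. by rewrite unitmx_inv unitmx_1addM. Qed.

Let pXS : is_psd (X *m S). Proof. exact: psd_resolvent. Qed.

Let EXS : X - H = A ^t* *m (X *m S) *m A.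
Proof. by rewrite {1}EX addrAC subrr add0r !mulmxA. Qed.

(** [A^* X S A = X - H] lies below [X], so its form vanishes on the kernel of [X]; as [X S] is
    positive semidefinite, [X S A] vanishes there too. Thus [T] leaves this kernel invariant. *)
Lemma closed_loop_submx : (X *m (S *m A) <= X)%MS.
Proof.
have /submxP[Z EZ] : (A ^t* *m (X *m S) *m A <= X)%MS.
  apply: psd_submx; first exact: psd_congr.
  by rewrite -EXS opprD addrA subrr add0r opprK.
rewrite submxE; apply/eqP; set N := cokermx X.
suff /(congr1 (fun A => A ^t* )) : (A *m N) ^t* *m (X *m S) = 0.
  by rewrite (adjmxM (_ ^t* )) trmxCK (psd_herm pXS) adjmx0 !mulmxA.
apply: psd_ker => //; rewrite trmxCK adjmxM.
have -> : N ^t* *m A ^t* *m (X *m S) *m (A *m N) =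
  N ^t* *m (A ^t* *m (X *m S) *m A) *m N by rewrite !mulmxA.
by rewrite EZ -!mulmxA mulmx_coker !mulmx0.
Qed.

Lemma open_loop_submx : (X *m A <= X)%MS.
Proof.
have uXG : invmx (1%:M + X *m G) \in unitmx by rewrite unitmx_inv unitmx_1addM.
have XS : X *m S = invmx (1%:M + X *m G) *m X by exact: mulmx_resolvent.
have := closed_loop_submx; rewrite !submxE (mulmxA X S) XS => /eqP E.
by apply/eqP/(can_inj (mulKmx uXG)); rewrite mulmx0 -E !mulmxA.
Qed.

(** [V] represents the action of [T] on the rows of [X]. The left-hand side is the source term in
    the recursion [gram_defectS] of the defects; completing the square with [X - H = A^* X S A]
    shows it to be nonnegative. *)
Lemma gram_defect_step V : V *m X = X *m (S *m A) ->
  X *m S - V *m X *m V ^t* =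
  (1%:M - A *m V ^t* ) ^t* *m (X *m S) *m (1%:M - A *m V ^t* ) +
  V *m H *m V ^t* .
Proof.
move=> EV; have hX := psd_herm pX; have hXS := psd_herm pXS.
have EV' : X *m V ^t* = A ^t* *m (X *m S).
  by rewrite -[X in X *m V ^t* ]hX -adjmxM EV -hXS -adjmxM mulmxA.
have VHV : V *m H *m V ^t* =
    V *m X *m V ^t* - V *m (A ^t* *m (X *m S) *m A) *m V ^t* .
  by rewrite -mulmxBl -mulmxBr -EXS opprD opprK addrA subrr add0r.
rewrite VHV; set c := V *m (A ^t* *m (X *m S) *m A) *m V ^t* .
set a := V *m X *m V ^t* .
have aE1 : V *m A ^t* *m (X *m S) = V *m X *m V ^t* .
  by rewrite -!mulmxA EV' mulmxA.
have aE2 : X *m S *m (A *m V ^t* ) = a by rewrite /a EV !mulmxA.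
have cE : V *m A ^t* *m (X *m S) *m (A *m V ^t* ) = c by rewrite /c !mulmxA.
rewrite adjmxB adjmx1 adjmxM trmxCK mulmxBl mul1mx mulmxBr mulmx1.
by rewrite (mulmxBl (X *m S)) aE2 cE aE1 subrK.
Qed.

(* On the left kernel [K] of the defect [D], [V A^*] acts as the identity modulo
   the kernel of [X] and [K V H = 0]: these are unstable modes which [H] does
   not observe, hence which no fixed-point iterate [h j] sees. *)
Lemma gram_defect_full V D (h : nat -> 'M[C]_n) :
    V *m X = X *m (S *m A) -> is_psd D ->
    D = X *m S - V *m X *m V ^t* + V *m D *m V ^t* ->
    h 0%N = 0 ->
    (forall j, h j.+1 =
       H + A ^t* *m h j *m invmx (1%:M + G *m h j) *m A) ->
    (forall j, is_psd (h j)) -> (forall j, is_psd (X - h j)) ->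
    (forall K : 'M[C]_n, (forall j, K *m h j = 0) -> K *m X = 0) ->
  (X <= D)%MS.
Proof.
move=> EV pD ED h0 hS ph pXh hX_lim; set K := kermx D.
have KD : K *m D = 0 by exact: mulmx_ker.
have hX := psd_herm pX; have hD := psd_herm pD.
set B := 1%:M - A *m V ^t* ; pose Q1 := B ^t* *m (X *m S) *m B.
have pQ1 : is_psd (K *m Q1 *m K ^t* ) by exact/psd_congrV/psd_congr.
have pQ2 : is_psd (K *m (V *m H *m V ^t* ) *m K ^t* ).
  by exact/psd_congrV/psd_congrV.
have pQ3 : is_psd (K *m (V *m D *m V ^t* ) *m K ^t* ).
  by exact/psd_congrV/psd_congrV.
(* By [gram_defect_step], [K D K^* = 0] is a sum of three nonnegative terms, so each vanishes;
   [KBX], [KVH] and [KVD] are what this gives. *)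
have Q0 : K *m Q1 *m K ^t* + (K *m (V *m H *m V ^t* ) *m K ^t* +
    K *m (V *m D *m V ^t* ) *m K ^t* ) = 0.
  rewrite -!mulmxDl -!mulmxDr addrA -gram_defect_step // -ED.
  by rewrite KD mul0mx.
have Q10 := psd_addr_eq0 pQ1 (psdD pQ2 pQ3) Q0.
move: Q0; rewrite Q10 add0r => Q0.
have Q20 := psd_addr_eq0 pQ2 pQ3 Q0.
move: Q0; rewrite Q20 add0r => Q30.
have KVH : K *m V *m H = 0.
  by apply: psd_ker => //; rewrite adjmxM -Q20 !mulmxA.
have KVD : K *m V *m D = 0.
  by apply: psd_ker => //; rewrite adjmxM -Q30 !mulmxA.
have KBX : K *m B ^t* *m (X *m S) = 0.
  by apply: psd_ker => //; rewrite adjmxM trmxCK -Q10 /Q1 !mulmxA.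
have KX : K *m X = K *m V *m A ^t* *m X.
  move: KBX; rewrite mulmxA => /(canRL (mulmxK uS)); rewrite mul0mx.
  rewrite /B adjmxB adjmx1 adjmxM trmxCK mulmxBr mulmx1 mulmxBl !mulmxA.
  by move/eqP; rewrite subr_eq0 => /eqP.
have /submxP[Y EY] : (K *m V <= K)%MS by rewrite sub_kermx KVD.
(* [K V X = K X T], so [T] maps the row space of [K X] into itself; it does so
   injectively, hence onto, because [K X = K V A^* X] factors through [K V X]. *)
have /submxP[E EE] : (K *m X <= K *m V *m X)%MS.
  have /submxP[Z EZ] := open_loop_submx.
  have sub : (K *m V *m X <= K *m X)%MS by rewrite EY -mulmxA submxMl.
  rewrite -(geq_leqif (mxrank_leqif_sup sub)) KX.
  have -> : K *m V *m A ^t* *m X = K *m V *m X *m Z ^t* .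
    rewrite -(mulmxA _ _ X) -(mulmxA _ X); congr (_ *m _).
    by rewrite -[X in _ *m X]hX -adjmxM EZ adjmxM hX.
  exact: mxrankM_maxl.
have hsub j : exists Z, h j = X *m Z.
  have /submxP[Z EZ] := psd_submx (ph j) (pXh j).
  by exists (Z ^t* ); rewrite -(psd_herm (ph j)) EZ adjmxM hX.
(* By [KVH] and [KX], [K V h_(j+1) = K V A^* h_j (...) = K h_j (...) = 0], since [h_j] factors
   through [X]; then [K X = E K V X] removes [V]. *)
have Kh j : K *m h j = 0.
  elim: j => [|j IH]; first by rewrite h0 mulmx0.
  have [Z EZ] := hsub j.+1; have [Z' EZ'] := hsub j.
  have KVAh : K *m V *m A ^t* *m h j = K *m h j by rewrite EZ' !mulmxA -KX.
  have KVh : K *m V *m h j.+1 = 0.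
    by rewrite hS mulmxDr KVH add0r !mulmxA KVAh IH !mul0mx.
  rewrite EZ mulmxA EE -(mulmxA E) -(mulmxA (K *m V)) -EZ.
  by rewrite KVh mulmx0.
have KX0 := hX_lim K Kh.
rewrite submxE; apply/eqP; set N := cokermx D.
suff /(congr1 (fun A => A ^t* )) : N ^t* *m X = 0.
  by rewrite adjmxM trmxCK hX adjmx0.
have /submxP[Z ->] : (N ^t* <= K)%MS.
  by rewrite sub_kermx -hD -adjmxM mulmx_coker adjmx0.
by rewrite -mulmxA KX0 mulmx0.
Qed.

(** For [M = X + X g X] and the generalized inverse [B] of [X], one has [Dj B M = X] and
    [E D B M = X B M = M]. The result is a fixed-point equation that bounds [M] once [Dj] is close
    to [D]. *)
Lemma gram_defect_inverse g W D E :
  g = (1%:M + g *m X) *m W -> X = E *m D ->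
  let Dj := X - X *m W *m X in
  X + X *m g *m X =
    E *m X - E *m (Dj - D) *m pinvmx X *m (X + X *m g *m X).
Proof.
move=> Eg EED Dj; set B := pinvmx X.
have XBX : X *m B *m X = X by apply: mulmxKpV.
have inv1 : (1%:M + g *m X) *m (1%:M - W *m X) = 1%:M.
  by rewrite mulmxBr mulmx1 mulmxA -Eg addrK.
have inv2 := mulmx1C inv1.
have EM : X + X *m g *m X = X *m (1%:M + g *m X).
  by rewrite mulmxDr mulmx1 mulmxA.
have XBM : X *m B *m (X + X *m g *m X) = X + X *m g *m X.
  by rewrite {1}EM mulmxA XBX -EM.
have DBM : Dj *m B *m (X + X *m g *m X) = X.
  have -> : Dj = (1%:M - X *m W) *m X by rewrite mulmxBl mul1mx.
  rewrite -(mulmxA _ X B) -(mulmxA _ (X *m B)) XBM EM mulmxA.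
  have -> : (1%:M - X *m W) *m X = X *m (1%:M - W *m X).
    by rewrite mulmxBl mulmxBr mul1mx mulmx1 mulmxA.
  by rewrite -mulmxA inv2 mulmx1.
have -> : E *m (Dj - D) *m B *m (X + X *m g *m X) =
    E *m (Dj *m B *m (X + X *m g *m X)) - E *m D *m B *m (X + X *m g *m X).
  by rewrite mulmxBr (mulmxBl (E *m Dj)) (mulmxBl (E *m Dj *m B)) !(mulmxA E).
by rewrite DBM -EED XBM opprB addrCA subrr addr0.
Qed.

End Solution.

End Kernels.

(** * Fixed-point iterates, their levels and the decreasing defects *)

Section Iterates.

Variables (C : numClosedFieldType) (n : nat) (A G H : 'M[C]_n).
Hypotheses (pG : is_psd G) (pH : is_psd H).
Implicit Types X Y : 'M[C]_n.

(* [dareR] is the instance [C := R[i]]. *)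
Definition ric X : 'M[C]_n := H + A ^t* *m X *m invmx (1%:M + G *m X) *m A.

Lemma psd_ric X : is_psd X -> is_psd (ric X).
Proof.
move=> pX; rewrite /ric; apply: psdD => //; rewrite -(mulmxA _ X).
exact/psd_congr/psd_resolvent.
Qed.

Lemma ric_mono X Y : is_psd X -> is_psd Y -> is_psd (Y - X) ->
  is_psd (ric Y - ric X).
Proof.
move=> pX pY pXY; have -> : ric Y - ric X =
    A ^t* *m (Y *m invmx (1%:M + G *m Y) - X *m invmx (1%:M + G *m X)) *m A.
  by rewrite mulmxBr mulmxBl /ric opprD addrACA subrr add0r !mulmxA.
exact/psd_congr/resolvent_mono.
Qed.

Definition fpi j : 'M[C]_n := iter j ric 0.

Lemma fpiS j : fpi j.+1 =
  H + A ^t* *m fpi j *m invmx (1%:M + G *m fpi j) *m A.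
Proof. by []. Qed.

Lemma psd_fpi j : is_psd (fpi j).
Proof. by elim: j => [|j IH]; [exact: psd0 | exact: psd_ric]. Qed.

Lemma psd_fpiS j : is_psd (fpi j.+1 - fpi j).
Proof.
elim: j => [|j IH]; first by rewrite subr0; exact: psd_fpi.
exact: ric_mono (psd_fpi _) (psd_fpi _) IH.
Qed.

Lemma psd_fpi_le Y j : is_psd Y -> is_psd (Y - ric Y) -> is_psd (Y - fpi j).
Proof.
move=> pY sY; elim: j => [|j IH]; first by rewrite subr0.
have -> : Y - fpi j.+1 = (Y - ric Y) + (ric Y - fpi j.+1).
  by rewrite addrA subrK.
exact: psdD sY (ric_mono (psd_fpi j) pY IH).
Qed.

Section Defect.

Variable X : 'M[C]_n.
Hypotheses (pX : is_psd X) (EX : X = ric X).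
Let S := invmx (1%:M + G *m X).
Let T := S *m A.
Let G' := S *m G.
Let W := closed_loop_gram T G'.

(** [R_d(h_j)] is the third component of [F] applied to [(A, G, H)] and a triple of level [j], so
    each iteration adds 1 to the level. Level 0 is the triple [(1, 0, 0)]. *)
Lemma fpi_level j : exists a g, afpi_level X T G' j a g (fpi j).
Proof.
elim: j => [|j [a [g lev]]].
  exists 1%:M, 0; split; rewrite ?mul0mx ?mulmx0 ?addr0 ?mul1mx //.
  - exact: psd0.
  - exact: psd0.
  - by rewrite /closed_loop_gram big_ord0.
  by rewrite subr0 expr0 -idmxE adjmx1 !mul1mx mulmx1.
have := afpi_levelM pX (afpi_level1 pG pH pX EX) lev.
by move=> lev'; eexists; eexists; exact: lev'.
Qed.

Lemma psd_closed_loop_gramS j : is_psd (W j.+1 - W j).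
Proof.
rewrite /W /closed_loop_gram big_ord_recr /= addrAC subrr add0r.
exact/psd_congrV/psd_resolventV.
Qed.

Lemma psd_closed_loop_gram j : is_psd (W j).
Proof.
elim: j => [|j IH]; first by rewrite /W /closed_loop_gram big_ord0; exact: psd0.
have -> : W j.+1 = (W j.+1 - W j) + W j by rewrite subrK.
exact: psdD (psd_closed_loop_gramS j) IH.
Qed.

(** The Gramian identity of a level makes [1 - W_j X] the inverse of [1 + g X], so the defect is the
    resolvent [X (1 + g X)^-1]. *)
Lemma psd_gram_defect j : is_psd (X - X *m W j *m X).
Proof.
have [a [g [pg _ _ Eg _]]] := fpi_level j.
have inv1 : (1%:M + g *m X) *m (1%:M - W j *m X) = 1%:M.
  by rewrite mulmxBr mulmx1 mulmxA -Eg addrK.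
have -> : X - X *m W j *m X = X *m invmx (1%:M + g *m X).
  have u := unitmx_1addM pg pX.
  have <- : 1%:M - W j *m X = invmx (1%:M + g *m X).
    by rewrite -[LHS](mulKmx u) inv1 mulmx1.
  by rewrite mulmxBr mulmx1 mulmxA.
exact: psd_resolvent.
Qed.

(** From [W_(j+1) = G' + T W_j T^*], moving [T] across [X] as [V]. *)
Lemma gram_defectS V j : V *m X = X *m T ->
  X - X *m W j.+1 *m X =
  X *m S - V *m X *m V ^t* + V *m (X - X *m W j *m X) *m V ^t* .
Proof.
move=> EV; have hX := psd_herm pX.
have EV' : T ^t* *m X = X *m V ^t* .
  by rewrite -[X in _ *m X]hX -adjmxM -EV adjmxM hX.
have XS : X *m S = X - X *m G' *m X.
  by rewrite {1}/S invmx_1addM // mulmxBr mulmx1 /G' !mulmxA.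
have W1 : closed_loop_gram T G' 1 = G'.
  by rewrite /closed_loop_gram big_ord1 expr0 -idmxE adjmx1 mul1mx mulmx1.
rewrite -addn1 /W closed_loop_gramD W1 expr1 -/W XS.
have -> : X *m (G' + T *m W j *m T ^t* ) *m X =
    X *m G' *m X + V *m (X *m W j *m X) *m V ^t* .
  rewrite mulmxDr mulmxDl; congr (_ + _); move: (T) EV EV' => Z EZ EZ'.
  by rewrite !mulmxA -EZ -!mulmxA EZ'.
by rewrite mulmxBr mulmxBl opprD addrA [RHS]addrA subrK.
Qed.

(** [M] has [X] as a factor on the left and on the right, so the projections [X B^*] and [B X] fix
    it. *)
Lemma gram_middle g : let M := X + X *m g *m X in
  M = X *m (pinvmx X) ^t* *m M *m pinvmx X *m X.
Proof.
move=> M; set B := pinvmx X; have hX := psd_herm pX.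
have XBX : X *m B *m X = X by apply: mulmxKpV.
have XBX' : X *m B ^t* *m X = X.
  by have := congr1 (fun Z => Z ^t* ) XBX; rewrite !adjmxM hX mulmxA.
have EM1 : M = X *m (1%:M + g *m X) by rewrite mulmxDr mulmx1 mulmxA.
have EM2 : M = (1%:M + X *m g) *m X by rewrite mulmxDl mul1mx.
have -> : X *m B ^t* *m M = M by rewrite {1}EM1 mulmxA XBX' -EM1.
by rewrite [in RHS]EM2 -(mulmxA _ X B) -(mulmxA _ (X *m B)) XBX -EM2.
Qed.

(** This expresses the error through [X T^j], which tends to 0, whereas [T^j] itself may not. *)
Lemma afpi_level_error j a g h : afpi_level X T G' j a g h ->
  X - h = (X *m T ^+ j) ^t* *m (pinvmx X) ^t* *m (X + X *m g *m X) *m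
    pinvmx X *m (X *m T ^+ j).
Proof.
case=> _ _ _ _ ->; rewrite adjmxM (psd_herm pX).
have -> : (T ^+ j) ^t* *m (1%:M + X *m g) *m X *m T ^+ j =
    (T ^+ j) ^t* *m (X + X *m g *m X) *m T ^+ j.
  by rewrite -(mulmxA _ _ X) mulmxDl mul1mx.
by rewrite {1}(gram_middle g) !mulmxA.
Qed.

(** The nonnegative part [X g X] of the middle factor is dropped. *)
Lemma fpi_error_ge j : is_psd ((X - fpi j) - (T ^+ j) ^t* *m X *m T ^+ j).
Proof.
have [a [g [pg _ _ _ ->]]] := fpi_level j.
rewrite -(mulmxA _ _ X) mulmxDl mul1mx mulmxDr mulmxDl addrAC subrr add0r.
by apply: psd_congr; have := psd_congr X pg; rewrite (psd_herm pX).
Qed.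

End Defect.

End Iterates.

(** * Limits of complex matrices in the entrywise norm *)

Section MatrixLimits.

Variable R : realType.

Lemma normc_ge0 (x : R[i]) : 0 <= normc x.
Proof. by case: x => a b; exact: sqrtr_ge0. Qed.

Lemma normc_eq0P (x : R[i]) : normc x = 0 <-> x = 0.
Proof. by split=> [/eq0_normc|->] //; exact: normc0. Qed.

Lemma normc_conj (x : R[i]) : normc (x^* )%R = normc x.
Proof. by apply: (@complexI R); exact: (normcJ x). Qed.

Lemma ler_normc_ReIm (x : R[i]) : normc x <= `|complex.Re x| + `|complex.Im x|.
Proof.
case: x => a b /=.
rewrite -(ler_pXn2r (n := 2)) ?nnegrE ?addr_ge0 ?sqrtr_ge0 //.
rewrite sqr_sqrtr ?addr_ge0 ?sqr_ge0 // sqrrD !real_normK ?num_real //.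
by rewrite lerD2r lerDl mulrn_wge0 // mulr_ge0.
Qed.

Lemma ler_Re_normc (x : R[i]) : `|complex.Re x| <= normc x.
Proof.
case: x => a b /=; rewrite -(sqrtr_sqr a) ler_wsqrtr // lerDl; exact: sqr_ge0.
Qed.

Lemma ler_Im_normc (x : R[i]) : `|complex.Im x| <= normc x.
Proof.
case: x => a b /=; rewrite -(sqrtr_sqr b) ler_wsqrtr // lerDr; exact: sqr_ge0.
Qed.

Lemma normc_sum (I : finType) (F : I -> R[i]) :
  normc (\sum_i F i) <= \sum_i normc (F i).
Proof.
elim/big_ind2: _ => [|x a y b xa yb|//]; first by rewrite normc0.
exact: le_trans (le_normcD _ _) (lerD xa yb).
Qed.

(** A real-valued norm, submultiplicative also for rectangular matrices; [mxcvg] is convergence in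
    it. *)
Definition mxsum m n (M : 'M[R[i]]_(m, n)) : R := \sum_i \sum_j normc (M i j).

Lemma mxsum_ge0 m n (M : 'M[R[i]]_(m, n)) : 0 <= mxsum M.
Proof. by do 2!(apply: sumr_ge0 => ? _); exact: normc_ge0. Qed.

Lemma ler_mxsum m n (M : 'M[R[i]]_(m, n)) a b : normc (M a b) <= mxsum M.
Proof.
rewrite /mxsum (bigD1 a) //= (bigD1 b) //= -addrA lerDl.
by apply: addr_ge0; do ?(apply: sumr_ge0 => ? _); exact: normc_ge0.
Qed.

Lemma mxsum0 m n : mxsum (0 : 'M[R[i]]_(m, n)) = 0.
Proof.
by rewrite /mxsum big1 // => a _; rewrite big1 // => b _; rewrite mxE normc0.
Qed.

Lemma mxsum_eq0 m n (M : 'M[R[i]]_(m, n)) : mxsum M <= 0 -> M = 0.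
Proof.
move=> M0; apply/matrixP => a b; rewrite mxE; apply/normc_eq0P/eqP.
by rewrite eq_le normc_ge0 andbT (le_trans (ler_mxsum _ _ _)).
Qed.

Lemma mxsumD m n (M N : 'M[R[i]]_(m, n)) : mxsum (M + N) <= mxsum M + mxsum N.
Proof.
rewrite /mxsum -big_split /=; apply: ler_sum => a _.
by rewrite -big_split /=; apply: ler_sum => b _; rewrite mxE le_normcD.
Qed.

Lemma mxsumN m n (M : 'M[R[i]]_(m, n)) : mxsum (- M) = mxsum M.
Proof. by apply: eq_bigr => a _; apply: eq_bigr => b _; rewrite mxE normcN. Qed.

Lemma mxsumZ m n c (M : 'M[R[i]]_(m, n)) : mxsum (c *: M) = normc c * mxsum M.
Proof.
rewrite /mxsum mulr_sumr; apply: eq_bigr => a _.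
by rewrite mulr_sumr; apply: eq_bigr => b _; rewrite mxE normcM.
Qed.

Lemma mxsumM m n p (M : 'M[R[i]]_(m, n)) (N : 'M[R[i]]_(n, p)) :
  mxsum (M *m N) <= mxsum M * mxsum N.
Proof.
rewrite /mxsum mulr_suml; apply: ler_sum => a _.
rewrite mulr_suml.
rewrite (le_trans (y := \sum_b \sum_k normc (M a k) * normc (N k b))) //.
  apply: ler_sum => b _; rewrite mxE; apply: le_trans (normc_sum _) _.
  by apply: ler_sum => k _; rewrite normcM.
rewrite exchange_big /=; apply: ler_sum => k _; rewrite -mulr_sumr.
rewrite ler_wpM2l ?normc_ge0 // [leRHS](bigD1 k) //= lerDl.
by do 2!(apply: sumr_ge0 => ? _); exact: normc_ge0.
Qed.

Lemma mxsum_adj m n (M : 'M[R[i]]_(m, n)) : mxsum (M ^t* ) = mxsum M.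
Proof.
rewrite /mxsum exchange_big /=; apply: eq_bigr => a _; apply: eq_bigr => b _.
by rewrite !mxE; exact: normc_conj.
Qed.

Definition mxcvg m n (u : nat -> 'M[R[i]]_(m, n)) (L : 'M[R[i]]_(m, n)) : Prop :=
  mxsum (u j - L) @[j --> \oo] --> (0 : R).

Lemma cvg0_le (u v : nat -> R) : (forall j, 0 <= u j <= v j) ->
  v @ \oo --> (0 : R) -> u @ \oo --> (0 : R).
Proof.
move=> uv v0; apply: (squeeze_cvgr _ (cvg_cst 0) v0).
by near=> j; exact: uv.
Unshelve. all: by end_near. Qed.

Lemma cvg0_lbound (c : R) (v : nat -> R) : (forall j, c <= v j) ->
  v @ \oo --> (0 : R) -> c <= 0.
Proof. by move=> cv v0; apply: (cvgr_to_ge v0); near=> j; exact: cv.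
Unshelve. all: by end_near. Qed.

Lemma cvg0M (c : R) (v : nat -> R) :
  v @ \oo --> (0 : R) -> (fun j => c * v j) @ \oo --> (0 : R).
Proof. by move=> /(cvgMl_tmp (a := c)); rewrite mulr0. Qed.

Lemma cvg0D (u v : nat -> R) : u @ \oo --> (0 : R) -> v @ \oo --> (0 : R) ->
  (fun j => u j + v j) @ \oo --> (0 : R).
Proof.
by move=> u0 v0; rewrite -[0 in X in _ --> X](addr0 (0 : R)); exact: cvgD.
Qed.

Lemma mxcvg_le m n (u : nat -> 'M[R[i]]_(m, n)) L (v : nat -> R) :
  (forall j, mxsum (u j - L) <= v j) -> v @ \oo --> (0 : R) -> mxcvg u L.
Proof. by move=> uv; apply: cvg0_le => j; rewrite mxsum_ge0 uv. Qed.

Lemma mxcvg_unique m n (u : nat -> 'M[R[i]]_(m, n)) L L' :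
  mxcvg u L -> mxcvg u L' -> L = L'.
Proof.
move=> uL uL'; apply/eqP; rewrite -subr_eq0; apply/eqP/mxsum_eq0.
apply: (cvg0_lbound _ (cvg0D uL uL')) => j.
rewrite -(mxsumN (u j - L)) (_ : L - L' = - (u j - L) + (u j - L')).
  exact: mxsumD.
by rewrite opprB addrA subrK.
Qed.

Lemma eq_mxcvg m n (u v : nat -> 'M[R[i]]_(m, n)) L :
  u =1 v -> mxcvg u L -> mxcvg v L.
Proof. by move=> /funext ->. Qed.

Lemma mxcvg_mull m n p (A : 'M[R[i]]_(m, n)) (u : nat -> 'M[R[i]]_(n, p)) L :
  mxcvg u L -> mxcvg (fun j => A *m u j) (A *m L).
Proof.
move=> /(cvg0M (mxsum A)); apply: mxcvg_le => j.
by rewrite -mulmxBr; exact: mxsumM.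
Qed.

Lemma mxcvg_mulr m n p (A : 'M[R[i]]_(n, p)) (u : nat -> 'M[R[i]]_(m, n)) L :
  mxcvg u L -> mxcvg (fun j => u j *m A) (L *m A).
Proof.
move=> /(cvg0M (mxsum A)); apply: mxcvg_le => j.
by rewrite -mulmxBl mulrC; exact: mxsumM.
Qed.

Lemma mxcvgB m n (u v : nat -> 'M[R[i]]_(m, n)) L L' :
  mxcvg u L -> mxcvg v L' -> mxcvg (fun j => u j - v j) (L - L').
Proof.
move=> uL vL'; apply: mxcvg_le (cvg0D uL vL') => j.
rewrite -(mxsumN (v j - L')) (_ : _ - _ = (u j - L) + - (v j - L')).
  exact: mxsumD.
by rewrite !opprB addrACA [RHS]addrACA (addrC (- v j)).
Qed.

Lemma mxcvg_cst m n (L : 'M[R[i]]_(m, n)) : mxcvg (fun=> L) L.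
Proof. by rewrite /mxcvg subrr mxsum0; exact: cvg_cst. Qed.

Lemma mxcvgD m n (u v : nat -> 'M[R[i]]_(m, n)) L L' :
  mxcvg u L -> mxcvg v L' -> mxcvg (fun j => u j + v j) (L + L').
Proof.
move=> uL vL'; apply: mxcvg_le (cvg0D uL vL') => j.
by rewrite opprD addrACA; exact: mxsumD.
Qed.

Lemma mxcvgS m n (u : nat -> 'M[R[i]]_(m, n)) L :
  mxcvg u L -> mxcvg (fun j => u j.+1) L.
Proof. by rewrite /mxcvg -(cvg_shiftS (fun j => mxsum (u j - L))). Qed.

Lemma mxcvg_adj m n (u : nat -> 'M[R[i]]_(m, n)) L :
  mxcvg u L -> mxcvg (fun j => u j ^t* ) (L ^t* ).
Proof. by apply: mxcvg_le => j; rewrite -adjmxB mxsum_adj. Qed.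

Lemma ReB (x y : R[i]) : complex.Re (x - y) = complex.Re x - complex.Re y.
Proof. by case: x; case: y. Qed.

Lemma ImB (x y : R[i]) : complex.Im (x - y) = complex.Im x - complex.Im y.
Proof. by case: x; case: y. Qed.

Lemma ge0_lim (z : R[i]) (v : nat -> R[i]) (e : nat -> R) :
  (forall j, 0 <= v j) -> (forall j, normc (v j - z) <= e j) ->
  e @ \oo --> (0 : R) -> 0 <= z.
Proof.
move=> vge0 dz e0; rewrite lecE /=; apply/andP; split.
  rewrite -normr_eq0 eq_le normr_ge0 andbT; apply: (cvg0_lbound _ e0) => j.
  apply: le_trans (dz j); apply: le_trans (ler_Im_normc _).
  have v0 : complex.Im (v j) = 0 by have := vge0 j; rewrite lecE => /andP[/eqP].
  by rewrite ImB v0 sub0r normrN.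
rewrite -oppr_le0; apply: (cvg0_lbound _ e0) => j.
apply: le_trans (dz j); apply: le_trans (ler_Re_normc _).
apply: le_trans (ler_norm _); rewrite ReB -[leLHS]add0r lerD2r.
by have := vge0 j; rewrite lecE => /andP[].
Qed.

Lemma psd_lim n (u : nat -> 'M[R[i]]_n) L :
  (forall j, is_psd (u j)) -> mxcvg u L -> is_psd L.
Proof.
move=> pu uL; split.
  apply/hermsymmxP/(mxcvg_unique _ uL).
  by apply: eq_mxcvg (mxcvg_adj uL) => j; exact: psd_herm.
move=> x; have := mxcvg_mulr x (mxcvg_mull (x ^t* ) uL).
set z := (x ^t* *m L *m x) 0 0; set v := fun j => _ => vz.
apply: (ge0_lim (v := fun j => v j 0 0) _ _ vz) => j.
  by have [_] := pu j; apply.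
have := ler_mxsum (v j - x ^t* *m L *m x) 0 0.
by rewrite mxE [X in normc (_ + X)]mxE.
Qed.

Lemma cvg0_dist (f : nat -> R) : cvgn f ->
  `|f j - limn f| @[j --> \oo] --> (0 : R).
Proof.
move=> cf; suff /cvg_norm : (fun j => f j - limn f) @ \oo --> (0 : R).
  by rewrite normr0.
rewrite -[0 in X in _ --> X](subrr (limn f)).
by apply: cvgB => //; exact: cvg_cst.
Qed.

Lemma mxcvg_ReIm m n (u : nat -> 'M[R[i]]_(m, n)) :
  (forall a b, cvg (complex.Re (u j a b) @[j --> \oo])) ->
  (forall a b, cvg (complex.Im (u j a b) @[j --> \oo])) ->
  exists L, mxcvg u L.
Proof.
move=> cRe cIm.
pose L := \matrix_(a, b) (lim (complex.Re (u j a b) @[j --> \oo]) +i*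
                          lim (complex.Im (u j a b) @[j --> \oo])).
exists L; apply: (@mxcvg_le _ _ _ _ (fun j => \sum_a \sum_b
   (`|complex.Re (u j a b) - complex.Re (L a b)| +
    `|complex.Im (u j a b) - complex.Im (L a b)|))) => [j|].
  apply: ler_sum => a _; apply: ler_sum => b _.
  by rewrite !mxE; apply: le_trans (ler_normc_ReIm _) _; rewrite ReB ImB.
have sum0 (I : finType) (F : I -> nat -> R) : (forall k, F k @ \oo --> (0 : R)) ->
    (fun j => \sum_k F k j) @ \oo --> (0 : R).
  move=> F0; have := @cvg_big _ _ +%R 0 xpredT add_continuous nat \oo
    (index_enum I) F (fun=> 0) _ (fun k _ => F0 k).
  by rewrite big1_eq; apply.
apply: (sum0) => a; apply: (sum0) => b; apply: cvg0D.
- by rewrite mxE; exact: cvg0_dist.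
- by rewrite mxE; exact: cvg0_dist.
Qed.

Lemma sesqui_delta n (M : 'M[R[i]]_n) (a b : 'I_n) (c : R[i]) :
  let x := delta_mx a 0 + c *: delta_mx b 0 : 'cV[R[i]]_n in
  (x ^t* *m M *m x) 0 0 =
  M a a + conjc c * M b a + c * (M a b + conjc c * M b b).
Proof.
rewrite /= adjmxD linearZ /= map_mxZ !trmx_delta !map_delta_mx.
rewrite mulmxDl -scalemxAl -!rowE mulmxDr -scalemxAr -!colE.
by rewrite 12!mxE.
Qed.

(* With [c = 1] and [c = i] this recovers the entries of [M] from its quadratic
   form. *)
Lemma Re_sesqui_delta n (M : 'M[R[i]]_n) (a b : 'I_n) (c : R[i]) :
  M ^t* = M ->
  let x := delta_mx a 0 + c *: delta_mx b 0 : 'cV[R[i]]_n in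
  complex.Re ((x ^t* *m M *m x) 0 0) =
  complex.Re (M a a) + 2 * complex.Re (c * M a b) +
  complex.Re (c * conjc c * M b b).
Proof.
move=> hM /=; rewrite sesqui_delta.
have -> : M b a = conjc (M a b) by rewrite -[in LHS]hM !mxE.
case: c (M a a) (M a b) (M b b) => [c1 c2] [x1 x2] [y1 y2] [z1 z2] /=.
by ring.
Qed.

(** Each quadratic form is nondecreasing and bounded, hence converges; the entries are recovered
    from the forms at [e_a + c e_b] with [c] equal to 0, 1 and [i]. *)
Lemma psd_monotone_cvg n (u : nat -> 'M[R[i]]_n) S :
    (forall j, is_psd (u j)) -> (forall j, is_psd (u j.+1 - u j)) ->
    (forall j, is_psd (S - u j)) -> 
  exists L, [/\ mxcvg u L, is_psd L & forall j, is_psd (L - u j)].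
Proof.
move=> pu puS uS.
pose q (x : 'cV[R[i]]_n) j : R := complex.Re ((x ^t* *m u j *m x) 0 0).
have Re_le (x y : R[i]) : x <= y -> complex.Re x <= complex.Re y.
  by rewrite lecE => /andP[].
have q_cvg x : cvgn (q x).
  apply: nondecreasing_is_cvgn.
    apply/nondecreasing_seqP => j; apply: Re_le.
    have [_ /(_ x)] := puS j; rewrite mulmxBr mulmxBl.
    by rewrite mxE [X in _ + X]mxE subr_ge0.
  exists (complex.Re ((x ^t* *m S *m x) 0 0)) => _ [j _ <-]; apply: Re_le.
  have [_ /(_ x)] := uS j; rewrite mulmxBr mulmxBl.
  by rewrite mxE [X in _ + X]mxE subr_ge0.
have qE a b c j : q (delta_mx a 0 + c *: delta_mx b 0) j =
    complex.Re (u j a a) + 2 * complex.Re (c * u j a b) +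
    complex.Re (c * conjc c * u j b b).
  by rewrite /q Re_sesqui_delta //; exact: psd_herm.
have [L uL] : exists L, mxcvg u L.
  have q0E a j : q (delta_mx a 0) j = complex.Re (u j a a).
    by have := qE a a 0 j; rewrite scale0r !mul0r mulr0 !addr0.
  have ReE a b j : complex.Re (u j a b) =
      (q (delta_mx a 0 + 1 *: delta_mx b 0) j - q (delta_mx a 0) j
       - q (delta_mx b 0) j) / 2.
    rewrite qE !q0E; case: (u j a a) (u j a b) (u j b b) => ? ? [? ?] [? ?] /=.
    by field.
  have ImE a b j : complex.Im (u j a b) =
      (q (delta_mx a 0) j + q (delta_mx b 0) j
       - q (delta_mx a 0 + 'i%C *: delta_mx b 0) j) / 2.
    rewrite qE !q0E; case: (u j a a) (u j a b) (u j b b) => ? ? [? ?] [? ?] /=.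
    by field.
  apply: mxcvg_ReIm => a b.
    under eq_fun do rewrite ReE; apply: is_cvgMr_tmp.
    by apply: is_cvgB => //; apply: is_cvgB.
  under eq_fun do rewrite ImE; apply: is_cvgMr_tmp.
  by apply: is_cvgB => //; apply: is_cvgD.
exists L; split; [exact: uL | exact: psd_lim pu uL | move=> j].
suff H k : is_psd (u (k + j)%N - u j).
  apply: (psd_lim H); apply: mxcvgB (mxcvg_cst _).
  by move: uL; rewrite /mxcvg -(cvg_shiftn j).
elim: k => [|k IH]; first by rewrite subrr; exact: psd0.
rewrite addSn.
have -> : u (k + j).+1 - u j =
    (u (k + j).+1 - u (k + j)%N) + (u (k + j)%N - u j).
  by rewrite addrA subrK.
exact: psdD (puS _) IH.
Qed.

End MatrixLimits.

(** * Decay of [u T^j] from the roots of an annihilating polynomial *)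

Section SpectralDecay.

Variables (R : realType) (m n : nat) (T : 'M[R[i]]_n.+1).
Implicit Types (u : 'M[R[i]]_(m, n.+1)) (s : seq R[i]).

Lemma horner_mx_linear (z : R[i]) : horner_mx T ('X - z%:P) = T - z%:M.
Proof. by rewrite rmorphB /= horner_mx_X horner_mx_C. Qed.

Lemma mulmx_horner_exp u p j :
  u *m horner_mx T p *m T ^+ j = u *m T ^+ j *m horner_mx T p.
Proof.
rewrite -!mulmxA; congr (_ *m _).
by rewrite -[in T ^+ j](horner_mx_X T) -rmorphXn !mulmxE -!rmorphM mulrC.
Qed.

Lemma normcX (z : R[i]) j : normc (z ^+ j) = normc z ^+ j.
Proof. by elim: j => [|j IH]; rewrite ?expr0 ?normc1 // !exprS normcM IH. Qed.

Lemma horner_mx_stable u s :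
    mxcvg (fun j => u *m T ^+ j) 0 ->
    u *m horner_mx T (\prod_(z <- s) ('X - z%:P)) = 0 ->
  u *m horner_mx T (\prod_(z <- s | normc z < 1) ('X - z%:P)) = 0.
Proof.
elim: s u => [|z s IH] u uT0; first by rewrite !big_nil.
rewrite !big_cons rmorphM -mulmxE mulmxA => us0.
have stable p : mxcvg (fun j => u *m horner_mx T p *m T ^+ j) 0.
  have := mxcvg_mulr (horner_mx T p) uT0; rewrite mul0mx.
  by under [X in mxcvg X]eq_fun do rewrite -mulmx_horner_exp.
have := IH _ (stable ('X - z%:P)) us0; case: ifPn => z1 v0.
  by rewrite rmorphM -mulmxE mulmxA.
set p := (X in horner_mx T X) in v0 *; set w := u *m _.
have wT : w *m T = z *: w.
  move: v0; rewrite -mulmxA mulmxE -rmorphM mulrC rmorphM -mulmxE mulmxA -/w /=.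
  rewrite horner_mx_linear mulmxBr mul_mx_scalar => /eqP.
  by rewrite subr_eq0 => /eqP.
have wTj j : w *m T ^+ j = z ^+ j *: w.
  elim: j => [|j IHj]; first by rewrite !expr0 -idmxE mulmx1 scale1r.
  by rewrite exprSr -mulmxE mulmxA IHj -scalemxAl wT scalerA -exprSr.
have w0 : mxcvg (fun j => w *m T ^+ j) 0 by exact: stable.
apply: mxsum_eq0; apply: (cvg0_lbound _ w0) => j.
by rewrite subr0 wTj mxsumZ ler_peMl ?mxsum_ge0 // normcX exprn_ege1 // leNgt.
Qed.

(** Induction on the factors, by [u T^(j+1) = z u T^j + u (T - z) T^j]. The strict inequality
    [|z| < tau] absorbs the polynomial growth due to repeated roots. *)
Lemma horner_mx_decay u s (tau : R) : 0 < tau ->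
    (forall z, z \in s -> normc z < tau) ->
    u *m horner_mx T (\prod_(z <- s) ('X - z%:P)) = 0 ->
  exists C : R, forall j, mxsum (u *m T ^+ j) <= C * tau ^+ j.
Proof.
move=> tau0; elim: s u => [|z s IH] u s_lt.
  rewrite big_nil rmorph1 -idmxE mulmx1 => ->.
  by exists 0 => j; rewrite mul0mx mxsum0 mul0r.
rewrite big_cons rmorphM -mulmxE mulmxA => us0.
have [w ws|C vC] := IH _ _ us0; first by rewrite s_lt // in_cons ws orbT.
have z_lt : normc z < tau by rewrite s_lt // mem_head.
have tz : 0 < tau - normc z by rewrite subr_gt0.
(* Large enough for [j = 0] and for [|z| C' + C <= tau C']. *)
pose C' := Num.max (mxsum u) (C / (tau - normc z)).
exists C'; elim=> [|j IHj].
  by rewrite !expr0 -idmxE mulmx1 mulr1 le_max lexx.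
have -> : u *m T ^+ j.+1 =
    z *: (u *m T ^+ j) + u *m horner_mx T ('X - z%:P) *m T ^+ j.
  rewrite horner_mx_linear exprS mulmxBr mulmxBl mul_mx_scalar scalemxAl.
  by rewrite addrC subrK -mulmxE mulmxA.
apply: le_trans (mxsumD _ _) _; rewrite mxsumZ.
apply: le_trans (lerD (ler_wpM2l (normc_ge0 z) IHj) (vC j)) _.
have CC' : C <= C' * (tau - normc z).
  by rewrite -ler_pdivrMr // le_max lexx orbT.
rewrite exprS !mulrA -mulrDl ler_pM2r ?exprn_gt0 //.
by move: CC'; rewrite mulrBr => CC'; lra.
Qed.

End SpectralDecay.

(** * Comparison of an induced norm with the entrywise norm *)

Section InducedNorm.

Variables (R : realType) (n : nat) (N : 'cV[R[i]]_n -> R).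
Hypothesis hN : vector_norm N.

Let N0 : N 0 = 0.
Proof. by have [_ _ NZ] := hN; rewrite -(scale0r 0) NZ normc0 mul0r. Qed.

Let NN x : N (- x) = N x.
Proof.
have [_ _ NZ] := hN.
by rewrite -scaleN1r NZ normcN normc1 mul1r.
Qed.

Let N_ge0 x : 0 <= N x.
Proof.
have [_ ND _] := hN; have := ND x (- x); rewrite subrr N0 NN.
by rewrite -mulr2n pmulrn_lge0.
Qed.

Let N_sum (x : 'cV[R[i]]_n) :
  N x <= \sum_a normc (x a 0) * N (delta_mx a 0).
Proof.
have [_ ND NZ] := hN.
have -> : x = \sum_a x a 0 *: delta_mx a 0.
  rewrite {1}(matrix_sum_delta x); apply: eq_bigr => a _.
  by rewrite big_ord1.
apply: (le_trans (y := \sum_a N (x a 0 *: delta_mx a 0))).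
  elim/big_ind2: _ => [|u a v b ua vb|//]; first by rewrite N0.
  exact: le_trans (ND _ _) (lerD ua vb).
apply: ler_sum => a _; rewrite NZ summxE (bigD1 a) //= big1 ?addr0.
  by rewrite !mxE !eqxx mulr1.
by move=> k /negPf ka; rewrite !mxE eq_sym ka mulr0.
Qed.

Let K := \sum_a N (delta_mx a 0).

(** Complex vectors are read as real ones of length [2n], where closed bounded sets are compact. *)
Let cvec (v : 'rV[R]_(n + n)) : 'cV[R[i]]_n :=
  \col_k (v 0 (lshift n k) +i* v 0 (rshift n k)).

Let ler_entry (v : 'rV[R]_(n + n)) k : `|v 0 k| <= `|v|.
Proof.
rewrite [leRHS]/Num.norm /= mx_normrE.
by apply/bigmax_geP; right => /=; exists (0, k).
Qed.

Let N_cvec v : N (cvec v) <= 2 * K * `|v|.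
Proof.
apply: le_trans (N_sum _) _; rewrite /K mulrAC mulr_sumr.
apply: ler_sum => a _; apply: ler_wpM2r => //.
apply: le_trans (ler_normc_ReIm _) _; rewrite mxE /= mulr_natl mulr2n.
by apply: lerD; exact: ler_entry.
Qed.

Let cvecB v w : cvec (v - w) = cvec v - cvec w.
Proof. by apply/colP => k; rewrite !mxE. Qed.

Let N_lip v w : `|N (cvec v) - N (cvec w)| <= 2 * K * `|v - w|.
Proof.
have [_ ND _] := hN.
have H x y : N (cvec x) - N (cvec y) <= 2 * K * `|x - y|.
  apply: le_trans (N_cvec _); rewrite lerBlDr cvecB.
  by rewrite -[in leLHS](subrK (cvec y) (cvec x)); exact: ND.
by rewrite ler_norml H andbT lerNl opprB distrC.
Qed.

Let K_ge0 : 0 <= K. Proof. exact: sumr_ge0. Qed.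

Let N_cont : continuous (fun v => N (cvec v)).
Proof.
move=> v; apply/(@cvgrPdist_le _ _ _ (nbhs v)) => e e0.
have K1 : 0 < 2 * K + 1 by rewrite ltr_wpDl // mulr_ge0.
have e1 : 0 < (2 * K + 1)^-1 * e by rewrite mulr_gt0 // invr_gt0.
have near_v := @cvgr_dist_le _ _ _ (nbhs v) _ id v (fun _ => id) _ e1.
near=> w; have vw : `|v - w| <= (2 * K + 1)^-1 * e by near: w; exact: near_v.
apply: le_trans (N_lip v w) _.
apply: (le_trans (y := (2 * K + 1) * `|v - w|)).
  by apply: ler_wpM2r => //; rewrite lerDl.
by rewrite -ler_pdivlMl.
Unshelve. all: by end_near. Qed.

(** Equivalence of norms: [N] is continuous, so it has a minimum [mu] on the real unit sphere, and
    [mu > 0] by definiteness. *)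
Lemma vector_norm_ge_entry :
  exists2 c : R, 0 <= c & forall (x : 'cV[R[i]]_n) b, normc (x b 0) <= c * N x.
Proof.
have [Ndef _ NZ] := hN.
pose cvecV (x : 'cV[R[i]]_n) : 'rV[R]_(n + n) :=
  row_mx (\row_k complex.Re (x k 0)) (\row_k complex.Im (x k 0)).
have cvecK x : cvec (cvecV x) = x.
  apply/colP => k; rewrite mxE row_mxEl row_mxEr !mxE.
  by case: (x k 0).
have entry_le (x : 'cV[R[i]]_n) b : normc (x b 0) <= 2 * `|cvecV x|.
  rewrite -{1}(cvecK x) mxE; apply: le_trans (ler_normc_ReIm _) _ => /=.
  by rewrite mulr_natl mulr2n; apply: lerD; exact: ler_entry.
have cvecZ (a : R) v : cvec (a *: v) = a%:C *: cvec v.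
  by apply/colP => k; rewrite !mxE /=; simpc.
pose A := [set v : 'rV[R]_(n + n) | `|v| = 1].
have normA v : v != 0 -> A (`|v|^-1 *: v).
  by move=> v0; rewrite /A /= normrZ normfV normr_id mulVf // normr_eq0.
(* The sphere is empty only for [n = 0], when every vector is zero. *)
have [A0|A0] := pselect (A !=set0); last first.
  exists 0 => // x b; rewrite mul0r; apply: le_trans (entry_le x b) _.
  have [->|/normA v0] := eqVneq (cvecV x) 0; first by rewrite normr0 mulr0.
  by case: A0; eexists; exact: v0.
have cA : compact A.
  apply: bounded_closed_compact.
    exists 1; split=> // M M1 v vA; apply: (le_trans _ (ltW M1)).
    by rewrite le_eqVlt; apply/orP; left; apply/eqP; exact: vA.
  apply: (@preimage_closed _ _ (fun v : 'rV[R]_(n + n) => `|v|) [set x | x = 1]).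
    by move=> v _; exact: norm_continuous.
  exact: closed_eq.
have [c cinA cmin] := compact_EVT_min A0 cA (continuous_subspaceT N_cont).
have c1 : `|c| = 1 by move: cinA; rewrite inE.
have c0 : c != 0 by rewrite -normr_eq0 c1 oner_eq0.
set mu := N (cvec c) in cmin.
have mu0 : 0 < mu.
  rewrite lt_def N_ge0 andbT; apply: contra_neq c0 => /Ndef c0.
  apply/rowP => k; rewrite mxE -(splitK k); case: (fintype.split k) => k' /=.
    by have := congr1 (fun M : 'cV[R[i]]_n => complex.Re (M k' 0)) c0; rewrite !mxE.
  by have := congr1 (fun M : 'cV[R[i]]_n => complex.Im (M k' 0)) c0; rewrite !mxE.
exists (2 / mu) => [|x b]; first by rewrite divr_ge0 // ltW.
apply: le_trans (entry_le x b) _; rewrite -mulrA ler_pM2l //.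
have [->|v0] := eqVneq (cvecV x) 0; first by rewrite normr0 mulr_ge0 // invr_ge0 ltW.
have vA : `|cvecV x|^-1 *: cvecV x \in A by rewrite inE; exact: normA.
have := cmin _ vA; rewrite cvecZ NZ cvecK /= expr0n addr0 sqrtr_sqr ger0_norm ?invr_ge0 //.
by rewrite !ler_pdivlMl ?normr_gt0 // mulrC.
Qed.

(** When the set has no supremum, [sup] takes the value 0. *)
Lemma induced_norm_ge0 M : 0 <= induced_norm N M.
Proof.
rewrite /induced_norm; set E := image _ _.
have [[[y Ey] ubE]|/sup_out -> //] := pselect (has_sup E).
have [x _ xy] := Ey.
by apply: le_trans (ub_le_sup ubE Ey); rewrite -xy N_ge0.
Qed.

Lemma induced_norm_le_mxsum :
  exists2 c : R, 0 <= c & forall M, induced_norm N M <= c * mxsum M.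
Proof.
have [c c0 entry_le] := vector_norm_ge_entry.
exists (c * K) => [|M]; first by rewrite mulr_ge0.
rewrite /induced_norm; set E := image _ _.
have [E0|/set0P/negP/negPn/eqP ->] := pselect (E !=set0); last first.
  by rewrite sup0 !mulr_ge0 // mxsum_ge0.
apply: ge_sup => // _ [x Nx <-]; apply: le_trans (N_sum _) _.
rewrite /K mulrAC mulr_sumr; apply: ler_sum => a _; apply: ler_wpM2r => //.
rewrite mxE; apply: le_trans (normc_sum _) _.
apply: (le_trans (y := \sum_k c * normc (M a k))).
  apply: ler_sum => k _; rewrite normcM mulrC ler_wpM2r ?normc_ge0 //.
  by have := entry_le x k; rewrite Nx mulr1.
rewrite -mulr_sumr; apply: ler_wpM2l => //.
rewrite /mxsum [leRHS](bigD1 a) //= lerDl.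
by do 2!(apply: sumr_ge0 => ? _); exact: normc_ge0.
Qed.

End InducedNorm.

(** * Products, Gram matrices and limits superior of roots *)

Section Convergence.

Variable R : realType.

Lemma mxcvgM m n p (u : nat -> 'M[R[i]]_(m, n))
    (v : nat -> 'M[R[i]]_(n, p)) L L' :
  mxcvg u L -> mxcvg v L' -> mxcvg (fun j => u j *m v j) (L *m L').
Proof.
move=> uL vL'.
have uv0 : (fun j => mxsum (u j - L) * mxsum (v j - L')) @ \oo --> (0 : R).
  by rewrite -[0 in X in _ --> X](mulr0 (0 : R)); exact: cvgM.
have uL'0 := cvg0M (mxsum L') uL; have Lv0 := cvg0M (mxsum L) vL'.
apply: mxcvg_le (cvg0D (cvg0D uv0 uL'0) Lv0) => j.
have -> : u j *m v j - L *m L' =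
    (u j - L) *m (v j - L') + (u j - L) *m L' + L *m (v j - L').
  by rewrite -mulmxDr subrK mulmxBl mulmxBr addrA subrK.
apply: le_trans (mxsumD _ _) _; apply: lerD; last exact: mxsumM.
apply: le_trans (mxsumD _ _) _; apply: lerD; first exact: mxsumM.
by rewrite mulrC; exact: mxsumM.
Qed.

(** Entrywise, [|v_ab|^2 <= (v^* v)_bb <= e_bb]. *)
Lemma gram_cvg0 n (e v : nat -> 'M[R[i]]_n) :
  (forall j, is_psd (e j - (v j) ^t* *m v j)) -> mxcvg e 0 -> mxcvg v 0.
Proof.
move=> ev e0.
have entry_le j a b : normc (v j a b) <= Num.sqrt (mxsum (e j)).
  rewrite -(ler_pXn2r (n := 2)) ?nnegrE ?normc_ge0 ?sqrtr_ge0 //.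
  rewrite sqr_sqrtr ?mxsum_ge0 //; apply: le_trans (ler_mxsum _ b b).
  rewrite -lecR rmorphXn /=.
  have := psd_diag_ge0 b (ev j); rewrite mxE [X in _ + X]mxE subr_ge0.
  rewrite adjmx_mul_self => vb.
  have vab : `|v j a b| ^+ 2 <= \sum_k `|v j k b| ^+ 2.
    by rewrite (bigD1 a) //= lerDl sumr_ge0 // => k _; exact: exprn_ge0.
  have eb : 0 <= e j b b.
    by apply: le_trans vb; apply: sumr_ge0 => k _; exact: exprn_ge0.
  by apply: le_trans vab _; rewrite -(ger0_norm eb) in vb; exact: vb.
have cvg_sqrt : (fun j => Num.sqrt (mxsum (e j))) @ \oo --> (0 : R).
  have := e0; rewrite /mxcvg.
  under [X in X @ _ --> _ -> _]eq_fun do rewrite subr0.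
  rewrite -[X in _ -> _ --> X](sqrtr0 R).
  by move=> /(continuous_cvg _ (@sqrt_continuous R 0)).
apply: (mxcvg_le _ (cvg0M (n * n)%:R cvg_sqrt)) => j; rewrite subr0.
apply: (le_trans (y := \sum_(a < n) \sum_(b < n) Num.sqrt (mxsum (e j)))).
  by do 2!(apply: ler_sum => ? _).
by rewrite !sumr_const card_ord -mulrnA mulr_natl.
Qed.

(** The constant [c] disappears under the root: with [tau = d + e / 2], [c tau^J <= (d + e)^J] as
    soon as [J] is large. *)
Lemma limsup_root_le (x : nat -> R) (r : nat) (d : R) :
    (1 < r)%N -> 0 <= d -> (forall k, 0 <= x k) ->
    (forall tau, d < tau -> exists c : R,
      \forall k \near \oo, x k <= c * tau ^+ (r ^ k)) ->
  (limn_esup (fun k => (x k `^ ((r ^ k)%:R^-1))%:E) <= d%:E)%E.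
Proof.
move=> r1 d0 x0 xtau; apply/lee_addgt0Pr => e e0.
have de : 0 < d + e by rewrite ltr_wpDl.
have tau0 : 0 < d + e / 2 by rewrite ltr_wpDl // divr_gt0.
have [c xc] := xtau (d + e / 2) (ltac:(by rewrite ltrDl divr_gt0)).
pose q := (d + e / 2) / (d + e).
have q01 : 0 < q < 1.
  rewrite divr_gt0 //= ltr_pdivrMr // mul1r ltrD2l.
  by rewrite ltr_pdivrMr // ltr_pMr // ltr1n.
have cq0 : (fun j => c * q ^+ j) @ \oo --> (0 : R).
  apply: cvg0M; apply: cvg_expr; case/andP: q01 => q0 q1.
  by rewrite ger0_norm // ltW.
have [J _ cqJ] : \forall j \near \oo, c * q ^+ j <= 1.
  exact: (cvgr_le _ cq0 _ ltr01).
have near_le : \forall k \near \oo, x k <= (d + e) ^+ (r ^ k).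
  near=> k; apply: (@le_trans _ _ (c * (d + e / 2) ^+ (r ^ k))).
    by near: k; exact: xc.
  have -> : (d + e / 2) ^+ (r ^ k) = q ^+ (r ^ k) * (d + e) ^+ (r ^ k).
    by rewrite -exprMn /q divfK // gt_eqF.
  rewrite mulrA ler_piMl ?exprn_ge0 ?(ltW de) //; apply: cqJ => /=.
  apply: (@leq_trans k); last exact: ltnW (ltn_expl _ r1).
  by near: k; exact: nbhs_infty_ge.
(* The limit superior is an infimum of suprema over neighbourhoods of infinity, and the indices
   satisfying the bound form one. *)
apply: (@le_trans _ _ (ereal_sup [set (x k `^ ((r ^ k)%:R^-1))%:E |
    k in [set k | x k <= (d + e) ^+ (r ^ k)]])).
  by apply: ereal_inf_lbound; exists [set k | x k <= (d + e) ^+ (r ^ k)].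
apply: ge_ereal_sup => _ [k /= xk <-]; rewrite -EFinD lee_fin.
have rk : (r ^ k)%:R != 0 :> R by rewrite pnatr_eq0 expn_eq0 gtn_eqF // ltnW.
apply: (@le_trans _ _ (((d + e) ^+ (r ^ k)) `^ ((r ^ k)%:R^-1))).
  by apply: ge0_ler_powR => //; rewrite ?invr_ge0 ?ler0n ?nnegrE ?x0 ?exprn_ge0 ?(ltW de).
by rewrite -powR_mulrn ?(ltW de) // -powRrM divff // powRr1 ?(ltW de).
Unshelve. all: by end_near. Qed.

End Convergence.

(** * The limit of the iterates and the bound on the middle factor *)

Section MinimalSolution.

Variables (R : realType) (n : nat) (A G H : 'M[R[i]]_n).
Hypotheses (pG : is_psd G) (pH : is_psd H).
Let h := fpi A G H.

(** The iterates increase and stay below the supersolution [Y]. The resolvents [f (h_j)] converge by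
    monotonicity too, and passing to the limit in [f (h_j) (1 + G h_j) = h_j] identifies their limit
    as [f X]. *)
Lemma fpi_limit (Y : 'M[R[i]]_n) : is_psd Y -> is_psd (Y - ric A G H Y) ->
  exists X, [/\ is_psd X, X = ric A G H X, mxcvg h X
    & forall j, is_psd (X - h j)].
Proof.
move=> pY sY.
have ph j : is_psd (h j) by exact: psd_fpi.
have [X [hX pX Xh]] : exists L, [/\ mxcvg h L, is_psd L &
    forall j, is_psd (L - h j)].
  apply: (psd_monotone_cvg (S := Y)) => j; [exact: ph | exact: psd_fpiS |].
  exact: psd_fpi_le.
exists X; split; [exact: pX | | exact: hX | exact: Xh].
pose f Z := Z *m invmx (1%:M + G *m Z) : 'M[R[i]]_n.
have [F [fF _ _]] : exists L, [/\ mxcvg (fun j => f (h j)) L, is_psd L &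
    forall j, is_psd (L - f (h j))].
  apply: (psd_monotone_cvg (S := f X)) => j.
  - exact: psd_resolvent pG (ph j).
  - exact: resolvent_mono pG (ph j) (ph j.+1) (psd_fpiS A pG pH j).
  - exact: resolvent_mono pG (ph j) pX (Xh j).
have hGX : mxcvg (fun j => 1%:M + G *m h j) (1%:M + G *m X).
  exact: mxcvgD (mxcvg_cst _) (mxcvg_mull G hX).
have FE : F = f X.
  apply: (can_inj (mulmxK (unitmx_1addM pG pX))).
  rewrite /f mulmxKV ?unitmx_1addM //.
  apply: (mxcvg_unique _ hX); apply: eq_mxcvg (mxcvgM fF hGX) => j.
  by rewrite /f (mulmxKV (unitmx_1addM pG (ph j))).
apply: (mxcvg_unique (mxcvgS hX)); rewrite /ric -(mulmxA _ X) -/(f X) -FE.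
have := mxcvgD (mxcvg_cst H) (mxcvg_mulr A (mxcvg_mull (A ^t* ) fF)).
by apply: eq_mxcvg => j; rewrite /h fpiS /f mulmxA.
Qed.

Variable X : 'M[R[i]]_n.
Hypotheses (pX : is_psd X) (EX : X = ric A G H X) (hX : mxcvg h X).
Hypothesis Xh : forall j, is_psd (X - h j).
Let S := invmx (1%:M + G *m X).
Let T := S *m A.
Let W := closed_loop_gram T (S *m G).

(** With [X = F^* F], the error [X - h_j] dominates the Gram matrix of [F T^j]. *)
Lemma closed_loop_cvg0 : mxcvg (fun j => X *m T ^+ j) 0.
Proof.
have [F XF] := psd_factor pX.
have FT : mxcvg (fun j => F *m T ^+ j) 0.
  apply: (gram_cvg0 (e := fun j => X - h j)) => [j|].
    have := fpi_error_ge pG pH pX EX j; rewrite -/S -/T -/h.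
    by rewrite adjmxM mulmxA -(mulmxA _ (F ^t* )) -XF.
  by have := mxcvgB (mxcvg_cst X) hX; rewrite subrr.
have := mxcvg_mull (F ^t* ) FT; rewrite mulmx0.
by apply: eq_mxcvg => j; rewrite mulmxA -XF.
Qed.

(** The defects decrease to some [D] that satisfies their recursion, so [gram_defect_full] gives
    [X = E D]; the equation of [gram_defect_inverse] then has a small coefficient for large [j]. *)
Lemma middle_bounded : exists c : R, \forall j \near \oo,
  forall g, g = (1%:M + g *m X) *m W j ->
  mxsum (X + X *m g *m X) <= c.
Proof.
have /submxP[V EV] := closed_loop_submx pG pH pX EX.
have pXW j : is_psd (X *m W j *m X).
  have := psd_congr X (psd_closed_loop_gram A pG pX j).
  by rewrite (psd_herm pX).
have [Y [XWY _ _]] : exists L, [/\ mxcvg (fun j => X *m W j *m X) L, is_psd L &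
    forall j, is_psd (L - X *m W j *m X)].
  apply: (psd_monotone_cvg (S := X)) => j.
  - exact: pXW.
  - rewrite -mulmxBl -mulmxBr.
    have := psd_congr X (psd_closed_loop_gramS A pG pX j).
    by rewrite (psd_herm pX).
  - exact: (psd_gram_defect pG pH pX EX j).
pose D := X - Y; pose Dj j := X - X *m W j *m X.
have DjD : mxcvg Dj D by exact: mxcvgB (mxcvg_cst X) XWY.
have pD : is_psd D.
  by apply: (psd_lim _ DjD) => j; exact: (psd_gram_defect pG pH pX EX j).
have ED : D = X *m S - V *m X *m V ^t* + V *m D *m V ^t* .
  apply: (mxcvg_unique (mxcvgS DjD)).
  apply: eq_mxcvg (mxcvgD (mxcvg_cst (X *m S - V *m X *m V ^t* ))
    (mxcvg_mulr (V ^t* ) (mxcvg_mull V DjD))) => j; apply/esym.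
  exact: (gram_defectS pG pX j (esym EV)).
have /submxP[E XED] : (X <= D)%MS.
  have h_lim (K : 'M[R[i]]_n) : (forall j, K *m h j = 0) -> K *m X = 0.
    move=> Kh0; apply: (mxcvg_unique (mxcvg_mull K hX)).
    by apply: eq_mxcvg (mxcvg_cst 0) => j; rewrite Kh0.
  exact: (gram_defect_full pG pH pX EX (esym EV) pD ED
    (erefl : h 0%N = 0) (fpiS A G H) (psd_fpi A pG pH) Xh h_lim).
set B := pinvmx X.
have eta0 := cvg0M (mxsum B) (cvg0M (mxsum E) DjD).
(* A coefficient of at most 1/2 gives [|M| <= |E X| + |M| / 2], hence the bound [2 |E X|]. *)
have [J _ etaJ] : \forall j \near \oo,
    mxsum B * (mxsum E * mxsum (Dj j - D)) <= 2^-1.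
  by apply: (cvgr_le _ eta0); rewrite invr_gt0.
exists (2 * mxsum (E *m X)); exists J => // j Jj g Eg.
set M := X + X *m g *m X.
have ME : M = E *m X - E *m (Dj j - D) *m B *m M.
  exact: (gram_defect_inverse Eg XED).
have M_le : mxsum M <= mxsum (E *m X) + 2^-1 * mxsum M.
  rewrite {1}ME; apply: le_trans (mxsumD _ _) _; rewrite lerD2l mxsumN.
  apply: le_trans (mxsumM _ _) _; apply: ler_wpM2r; first exact: mxsum_ge0.
  apply: le_trans (etaJ j Jj); apply: le_trans (mxsumM _ _) _.
  by rewrite mulrC ler_wpM2l ?mxsum_ge0 // mxsumM.
by have := mxsum_ge0 M; lra.
Qed.

(** Levels add under [F], so the inner iterate of index [l] has level [r^k (l + 1)]. *)
Lemma afpi_level_afpi r k : (1 < r)%N ->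
  let: (a, g, hk) := afpi r A G H k in
  afpi_level X T (S *m G) (r ^ k) a g hk.
Proof.
move=> r1.
pose lev j (Y : 'M[R[i]]_n * 'M[R[i]]_n * 'M[R[i]]_n) :=
  let: (a, g, hk) := Y in afpi_level X T (S *m G) j a g hk.
have levF i j Y Z : lev i Y -> lev j Z -> lev (i + j)%N (afpiF Y Z).
  move: Y Z => [[a g] l] [[a' g'] l'] lY lZ.
  exact: (afpi_levelM pX lY lZ).
have lev_inner j Y l : lev j Y -> lev (j * l.+1)%N (afpi_inner Y l).
  move=> lY; elim: l => [|l IH]; first by rewrite muln1.
  by rewrite mulnS; exact: levF.
elim: k => [|k IH]; first exact: (afpi_level1 pG pH pX EX).
(* Index [r - 2] has level [r^k (r - 1)], and the last application of [F] adds [r^k]; [r > 1] makes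
   the truncated subtraction exact. *)
have -> : (r ^ k.+1 = r ^ k + r ^ k * (r - 2).+1)%N.
  by rewrite -mulnS expnSr; congr (_ * _)%N; rewrite -addn2 subnK.
exact: levF IH (lev_inner _ _ _ IH).
Qed.

End MinimalSolution.

(** * The stable spectral radius and the rate of convergence *)

Section Rate.

Variable R : realType.

Lemma exists_max_normc (s : seq R[i]) : s != [::] ->
  exists2 z, z \in s & forall w, w \in s -> normc w <= normc z.
Proof.
elim: s => [//|z s IH] _; have [->|/IH[w ws wmax]] := eqVneq s [::].
  by exists z; rewrite ?mem_head // => w; rewrite inE => /eqP ->.
have [zw|/ltW wz] := lerP (normc z) (normc w).
  exists w; first by rewrite in_cons ws orbT.
  by move=> v; rewrite in_cons => /predU1P[->|/wmax].
exists z; first exact: mem_head.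
by move=> v; rewrite in_cons => /predU1P[->|/wmax vw] //; exact: le_trans vw wz.
Qed.

(** The characteristic polynomial annihilates [u] by Cayley-Hamilton, and [horner_mx_stable]
    discards its roots outside the open disk. Some root remains, since the empty product would give
    [u = 0]. *)
Lemma stable_spectral_radius m n (T : 'M[R[i]]_n.+1) (u : 'M[R[i]]_(m, n.+1)) :
    u <> 0 -> mxcvg (fun j => u *m T ^+ j) 0 ->
  exists z, [/\ eigenvalue T z, normc z < 1,
    forall w, eigenvalue T w -> normc w < 1 -> normc w <= normc z
  & forall tau, normc z < tau ->
      exists c : R, forall j, mxsum (u *m T ^+ j) <= c * tau ^+ j].
Proof.
move=> u0 uT0.
have [s Es] : exists s : seq R[i], char_poly T = \prod_(z <- s) ('X - z%:P).
  have [s Es] := closed_field_poly_normal (char_poly T); exists s.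
  by rewrite [LHS]Es (monicP (char_poly_monic T)) scale1r.
have eigE z : eigenvalue T z = (z \in s).
  by rewrite eigenvalue_root_char Es root_prod_XsubC.
have us0 : u *m horner_mx T (\prod_(z <- s) ('X - z%:P)) = 0.
  by rewrite -Es Cayley_Hamilton mulmx0.
have := horner_mx_stable uT0 us0; rewrite -big_filter.
set s' := [seq w <- s | normc w < 1] => us'0.
have s'0 : s' != [::].
  apply/eqP => s'E; apply: u0; move: us'0.
  by rewrite s'E big_nil rmorph1 -idmxE mulmx1.
have [z zs' zmax] := exists_max_normc s'0.
move: (zs'); rewrite mem_filter => /andP[z1 zs].
exists z; split=> // [|w wT w1|tau ztau].
- by rewrite eigE.
- by apply: zmax; rewrite mem_filter w1 -eigE.
apply: horner_mx_decay us'0; first exact: le_lt_trans (normc_ge0 z) ztau.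
by move=> w ws'; exact: le_lt_trans (zmax w ws') ztau.
Qed.

(** [X T^j] occurs twice in the error, so a rate [t] for it becomes [t^2]. *)
Lemma afpi_error_bound (n r : nat) (A G H X : 'M[R[i]]_n) (t C : R) :
    (1 < r)%N -> is_psd G -> is_psd H -> is_psd X -> X = ric A G H X ->
    mxcvg (fpi A G H) X -> (forall j, is_psd (X - fpi A G H j)) ->
    (forall j, mxsum (X *m (dareT A G X) ^+ j) <= C * t ^+ j) ->
  exists c : R, \forall k \near \oo,
    mxsum (afpiH r A G H k - X) <= c * (t ^+ 2) ^+ (r ^ k).
Proof.
move=> r1 pG pH pX EX hX Xh XT_le.
have [c [J _ cJ]] := middle_bounded pG pH pX EX hX Xh.
set B := pinvmx X; pose b := mxsum B.
exists (C ^+ 2 * b ^+ 2 * c); near=> k.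
have Jk : (J <= r ^ k)%N.
  apply: (@leq_trans k); last exact: ltnW (ltn_expl _ r1).
  by near: k; exact: nbhs_infty_ge.
have := afpi_level_afpi pG pH pX EX k r1; rewrite /afpiH.
case: (afpi r A G H k) => [[a g] hk] lev; set j := (r ^ k)%N in Jk lev *.
have Eerr := afpi_level_error pX lev.
have [_ _ _ Eg _] := lev.
rewrite -mxsumN opprB Eerr; move: (cJ j Jk g Eg) (XT_le j).
move: (X + X *m g *m X) (X *m _ ^+ j) => M P Mc Pt; rewrite -/B.
apply: (@le_trans _ _ (mxsum P * b * mxsum M * b * mxsum P)).
  do 3!(apply: le_trans (mxsumM _ _) _; apply: ler_wpM2r; first exact: mxsum_ge0).
  by apply: le_trans (mxsumM _ _) _; rewrite !mxsum_adj.
have -> : C ^+ 2 * b ^+ 2 * c * (t ^+ 2) ^+ j =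
    (C * t ^+ j) * b * c * b * (C * t ^+ j).
  by rewrite -exprM mulnC exprM; ring.
by rewrite !ler_pM ?mulr_ge0 ?mxsum_ge0.
Unshelve. all: by end_near. Qed.

End Rate.

Theorem theorem4p1 (R : realType) (n r : nat) (A G H : 'M[R[i]]_n)
    (N : 'cV[R[i]]_n -> R)
    (hN : vector_norm N) (hr : (1 < r)%N)
    (hG : psdmx G) (hH : psdmx H)
    (hne : dare_supersol A G H !=set0) (hH0 : H <> 0) :
  exists Xs : 'M[R[i]]_n,
    [/\ dare_min_psd_sol A G H Xs,
        R_superlinear_cvg (induced_norm N) r (afpiH r A G H) Xs
      & exists m : R,
          is_max [set normc lam ^+ 2 |
                   lam in spectrum (dareT A G Xs) `&` @unit_disk R] m /\
          (limsup_root (induced_norm N) r (afpiH r A G H) Xs <= m%:E)%E].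
Proof.
case: n A G H N hN hG hH hne hH0 => [|n] A G H N hN hG hH [Y [pY [_ _ sY]]] hH0.
  (* A nonzero [H] excludes [n = 0]. *)
  by case: hH0; apply: flatmx0.
have [X [pX EX hX Xh]] := fpi_limit hG hH pY sY.
(* [X] dominates the first iterate, which is [H]. *)
have X0 : X <> 0.
  move=> X0; apply: hH0; apply: (psd_addr_eq0 hH (Xh 1%N)).
  have -> : fpi A G H 1 = H by rewrite fpiS mulmx0 !mul0mx addr0.
  by rewrite X0 sub0r subrr.
set T := dareT A G X.
have [z [zT z1 zmax zdecay]] :=
  stable_spectral_radius X0 (closed_loop_cvg0 hG hH pX EX hX).
have err_le : (limsup_root (induced_norm N) r (afpiH r A G H) X <=
    (normc z ^+ 2)%:E)%E.
  have [c c0 Nc] := induced_norm_le_mxsum hN.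
  apply: limsup_root_le => // [|k|tau ztau].
  - exact: sqr_ge0.
  - exact: induced_norm_ge0.
  have tau0 : 0 <= tau by exact: le_trans (sqr_ge0 _) (ltW ztau).
  (* The error is quadratic in [X T^j], so a rate [tau] requires the rate [sqrt tau] there. *)
  have zt : normc z < Num.sqrt tau.
    rewrite -(ltr_pXn2r (n := 2)) ?nnegrE ?normc_ge0 ?sqrtr_ge0 //.
    by rewrite sqr_sqrtr.
  have [C XT_le] := zdecay _ zt.
  have [c' errc'] := afpi_error_bound hr hG hH pX EX hX Xh XT_le.
  exists (c * c'); apply: filterS errc' => k errk.
  rewrite sqr_sqrtr // in errk; apply: le_trans (Nc _) _.
  by rewrite -mulrA ler_wpM2l.
exists X; split.
- split; first by split; [exact: pX | exact: EX].
  move=> Z [pZ EZ]; split; [by case: pZ | by case: pX |].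
  (* A solution is a supersolution, hence dominates every iterate and so their limit. *)
  have sZ : is_psd (Z - ric A G H Z).
    have -> : Z - ric A G H Z = 0 by rewrite -[ric A G H Z]EZ subrr.
    exact: psd0.
  exact: (psd_lim (fun j => psd_fpi_le hG hH j pZ sZ)
    (mxcvgB (mxcvg_cst Z) hX)).
- have z2 : normc z ^+ 2 < 1 by rewrite expr_lt1 ?normc_ge0.
  have z0 := sqr_ge0 (normc z).
  (* The bound must lie strictly between 0 and 1, while [|z|^2] may be 0; hence the midpoint between
     [|z|^2] and 1. *)
  exists ((1 + normc z ^+ 2) / 2); first by apply/andP; split; lra.
  by apply: le_trans err_le _; rewrite lee_fin; lra.
exists (normc z ^+ 2); split; last exact: err_le.
split; first by exists z.
move=> _ [w [wT w1] <-].
by rewrite ler_pXn2r ?nnegrE ?normc_ge0 //; exact: zmax.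
Qed.
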